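(* Let $t\ge1$ be an integer. (1) There exist infinitely many real multiquadratic fields $L$ with $\mathrm{Gal}(L/\mathbb{Q})\cong(\mathbb{Z}/2\mathbb{Z})^{2t}$ containing $3t$ totally positive units that are independent modulo squares in $L$; in particular $\delta(L)\ge 3t$. (2) There exist infinitely many real multiquadratic fields $L$ with $\mathrm{Gal}(L/\mathbb{Q})\cong(\mathbb{Z}/2\mathbb{Z})^{3t}$ containing $7t$ totally positive units that are independent modulo squares in $L$; in particular $\delta(L)\ge 7t$.
   Context: For a totally real field $F$ of degree $n$ and $0\neq\alpha\in F$, the signature of $\alpha$ is the vector in $\mathbb{F}_2^n$ whose entry at a real embedding $v$ is $0$ if $v(\alpha)>0$ and $1$ if $v(\alpha)<0$. The signatures of the units of $F$ form a subspace of $\mathbb{F}_2^n$ whose dimension is the unit signature rank of $F$; the deficiency $\delta(F)$ is $n$ minus the unit signature rank, which equals the $\mathbb{F}_2$-rank of the group of totally positive units of $F$ modulo squares of units. *)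

(* Defs.v *)
From HB Require Import structures.
From mathcomp Require Import all_boot all_order all_algebra all_fingroup all_field.
Set Implicit Arguments. Unset Strict Implicit. Unset Printing Implicit Defensive.
Import GRing.Theory Num.Theory.
Local Open Scope ring_scope.

Definition elem2 (n : nat) := [set: 'rV['F_2]_n].

Section NumberFieldDefs.
Variable L : splittingFieldType rat.

Definition is_alg_int (x : L) : Prop :=
  exists p : {poly int}, p \is monic /\ root (map_poly (fun z : int => z%:~R) p) x.

Definition is_unit_OL (x : L) : Prop :=
  x != 0 /\ is_alg_int x /\ is_alg_int x^-1.

Definition totally_real : Prop :=
  forall (f : {rmorphism L -> algC}) (x : L), f x \is Num.real.

Definition totally_positive (x : L) : Prop :=
  forall f : {rmorphism L -> algC}, 0 < f x.

Definition multiquadratic : Prop :=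
  exists s : seq L, all (fun a => a ^+ 2 \in 1%VS) s /\ <<1%VS & s>>%VS = fullv.

Definition gal_elem2 (n : nat) : Prop :=
  'Gal({:L} / 1%VS) \isog elem2 n.

Definition indep_mod_squares (k : nat) (u : 'I_k -> L) : Prop :=
  forall e : {ffun 'I_k -> bool},
    (exists y : L, \prod_(i | e i) u i = y ^+ 2) -> forall i, e i = false.

Definition indep_mod_unit_squares (k : nat) (u : 'I_k -> L) : Prop :=
  forall e : {ffun 'I_k -> bool},
    (exists y : L, is_unit_OL y /\ \prod_(i | e i) u i = y ^+ 2) ->
    forall i, e i = false.

(* delta(L) >= k, where delta(L) is the F_2-rank of the group of totally
   positive units modulo squares of units. *)
Definition deficiency_ge (k : nat) : Prop :=
  exists u : 'I_k -> L,
    (forall i, is_unit_OL (u i) /\ totally_positive (u i)) /\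
    indep_mod_unit_squares u.

Definition good_field (m c : nat) : Prop :=
  [/\ totally_real, multiquadratic, gal_elem2 m,
      (exists u : 'I_c -> L,
         (forall i, is_unit_OL (u i) /\ totally_positive (u i)) /\
         indep_mod_squares u)
    & deficiency_ge c].
End NumberFieldDefs.

Definition field_isomorphic (L1 L2 : splittingFieldType rat) : Prop :=
  exists f : {rmorphism L1 -> L2}, bijective f.

Definition infinitely_many_good (m c : nat) : Prop :=
  exists F : nat -> splittingFieldType rat,
    (forall i, good_field (F i) m c) /\
    (forall i j, i <> j -> ~ field_isomorphic (F i) (F j)).

(* Main.v *)
(** The fields are [Q(sqrt a_1, ..., sqrt a_r)] and the units are quadratic: for an
    integer [x > 0] the norm one element [u = x + sqrt (x^2 - 1)] is totally positive and
    [(1 + u)^2 = 2 (x + 1) u], so modulo squares [u] is the rational number [2 (x + 1)].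
    A rational number that becomes a square in the field is a product of some [a_i] times
    a rational square; hence everything reduces to finding positive integers such that
    the [x_j^2 - 1] lie in the group generated by the [a_i] modulo squares while
    the [a_i] and the [2 (x_j + 1)] together are independent modulo squares.

    If [l_0 < ... < l_r] and each difference [l_j - l_i] divides [l_i], then
    [x = 2 l_j / (l_j - l_i) - 1] is an integer, and modulo squares [x^2 - 1] is [l_i l_j]
    and [2 (x + 1)] is [l_j (l_j - l_i)].  Taking [a_k = l_0 l_k] and arranging by
    the Chinese remainder theorem that all the [l_i] and all their differences are
    independent gives [r (r + 1) / 2] units in rank [r], which is enough except for
    7 units in rank 3.  There the six pairs of [{M, M + 42, M + 44, M + 45}] give six
    units, and the seventh is a minimal solution [x^2 - d y^2 = 1] with [d] the squarefree
    part of [l_0 l_1 l_2 l_3].  For fixed primes [q] exactly dividing some [l_i], the class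
    [2 (x + 1)] has to satisfy quadratic residue conditions modulo [q] that no class in
    the group generated by 2, 3, 5, 7, 11 and the [l_i] satisfies, except the trivial
    one, which is excluded by minimality. *)
From HB Require Import structures.
Require Import Defs.
From Stdlib Require Import IndefiniteDescription.
From mathcomp Require Import all_boot all_order all_algebra all_fingroup all_solvable all_field.
From mathcomp Require Import mxabelem ring zify.
Set Implicit Arguments. Unset Strict Implicit. Unset Printing Implicit Defensive.
Import Order.TTheory GRing.Theory Num.Theory.
Local Open Scope ring_scope.

(** * Fields generated by square roots *)

(** [L] is finite over [F], so every element of an adjunction is a polynomial in the new generator;
    closure under sums and products is enough. *)
Lemma adjoin_seq_ind (F : fieldType) (L : fieldExtType F) (P : L -> Prop) :
    (forall c : F, P c%:A) -> (forall x y, P x -> P y -> P (x + y)) ->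
    (forall x y, P x -> P y -> P (x * y)) ->
  forall s, {in s, forall x, P x} -> {in <<1 & s>>%VS, forall v, P v}.
Proof.
move=> PF PD PM; elim/last_ind => [|s b IHs] Ps v.
  by rewrite Fadjoin_nil => /vlineP[c ->].
have {}IHs : {in <<1 & s>>%VS, forall v, P v}.
  by apply: IHs => x sx; apply: Ps; rewrite mem_rcons inE sx orbT.
rewrite adjoin_rcons => /Fadjoin_polyP[p /polyOverP Kp ->].
have P0 : P 0 by have := PF 0; rewrite scale0r.
have P1 : P 1 by have := PF 1; rewrite scale1r.
rewrite horner_coef; apply: (big_ind P) => // i _.
apply: (PM) => //; first exact: IHs.
elim: (i : nat) => [|n IHn]; rewrite ?expr0 // exprS; apply: PM => //.
by apply: Ps; rewrite mem_rcons mem_head.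
Qed.

(** * Kummer theory for square roots *)

Section Kummer.
Variables (F : fieldType) (L : fieldExtType F).
Implicit Types (K : {subfield L}) (b y : L).

Lemma Fadjoin_sqrtP K b y :
  b ^+ 2 \in K -> y \in <<K; b>>%VS ->
  exists u v, [/\ u \in K, v \in K & y = u + v * b].
Proof.
move=> b2K /Fadjoin_polyP[p /polyOverP Kp ->].
pose P (z : L) := exists u v, [/\ u \in K, v \in K & z = u + v * b].
rewrite horner_coef; apply: (big_ind P).
- by exists 0, 0; rewrite rpred0 mul0r addr0.
- move=> _ _ [u [v [Ku Kv ->]]] [u' [v' [Ku' Kv' ->]]].
  by exists (u + u'), (v + v'); rewrite !rpredD // mulrDl addrACA.
move=> i _; have E n : b ^+ n = b ^+ odd n * (b ^+ 2) ^+ n./2.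
  by rewrite -exprM mul2n -exprD odd_double_half.
rewrite {}E.
have Kc : p`_i * (b ^+ 2) ^+ i./2 \in K by rewrite rpredM // rpredX.
case: (odd i); rewrite /= ?expr1 ?expr0 ?mul1r.
- exists 0, (p`_i * (b ^+ 2) ^+ i./2); rewrite rpred0 add0r.
  by split=> //; rewrite mulrA mulrAC.
- by exists (p`_i * (b ^+ 2) ^+ i./2), 0; rewrite rpred0 mul0r addr0.
Qed.

(* Multiplying y = v * b by b moves it into K without leaving the elements
   whose square is in the ground field. *)
Lemma adjoin_sqrt_kummer (b : nat -> L) r y :
    (2%:R != 0 :> F) ->
    (forall i, (i < r)%N -> b i ^+ 2 \in 1%VS) ->
    y \in <<1 & mkseq b r>>%VS -> y ^+ 2 \in 1%VS ->
  exists e : nat -> bool, y * \prod_(i < r) b i ^+ e i \in 1%VS.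
Proof.
move=> nz2; elim: r y => [|r IHr] y b2.
  rewrite Fadjoin_nil => Fy _; exists xpred0.
  by rewrite big_ord0 mulr1.
have {}IHr z : z \in <<1 & mkseq b r>>%VS -> z ^+ 2 \in 1%VS ->
    exists e : nat -> bool, z * \prod_(i < r) b i ^+ e i \in 1%VS.
  by apply: IHr => i ltir; apply: b2; rewrite ltnS ltnW.
have extend z (c : bool) : (exists e : nat -> bool,
      z * b r ^+ c * \prod_(i < r) b i ^+ e i \in 1%VS) ->
    exists e : nat -> bool, z * \prod_(i < r.+1) b i ^+ e i \in 1%VS.
  case=> e De; exists (fun i => if i == r then c else e i).
  rewrite big_ord_recr /= eqxx mulrA mulrAC.
  under eq_bigr => i _ do rewrite ltn_eqF //.
  by [].
set K := <<1 & mkseq b r>>%AS in IHr *.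
rewrite mkseqS adjoin_rcons -/K => Ky y2.
have br2 : b r ^+ 2 \in 1%VS by apply: b2.
have br2K : b r ^+ 2 \in K by apply: (subvP (sub1v K)).
have [Kb | K'b] := boolP (b r \in K).
  apply: (extend _ false); rewrite expr0 mulr1; apply: IHr => //.
  by move/Fadjoin_idP: Kb => E; rewrite E in Ky.
have [u [v [Ku Kv Dy]]] := Fadjoin_sqrtP br2K Ky.
(* The squares of [y], [u], [v] and [b r] lie in [K], so a nonzero cross term of
   [(u + v * b r) ^+ 2] would put [b r] itself into [K]. *)
have uv0 : u * v = 0.
  apply: contraNeq K'b => nz_uv.
  have nz2L : 2%:R != 0 :> L by rewrite -(rmorph_nat (in_alg L)) fmorph_eq0.
  have nz_w : u * v * 2%:R != 0 by rewrite mulf_neq0.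
  have -> : b r = (y ^+ 2 - u ^+ 2 - v ^+ 2 * b r ^+ 2) / (u * v * 2%:R).
    by apply: (canRL (mulfK nz_w)); rewrite Dy; ring.
  have y2K : y ^+ 2 \in K by apply: (subvP (sub1v K)).
  have u2K : u ^+ 2 \in K by apply: rpredX.
  have v2K : v ^+ 2 \in K by apply: rpredX.
  apply: rpred_div; first by apply: rpredB; [exact: rpredB | exact: rpredM].
  by apply: rpredM; [exact: rpredM | exact: rpred_nat].
case/eqP: uv0; rewrite mulf_eq0 => /orP[]/eqP z0.
  apply: (extend _ true); apply: IHr.
    by rewrite Dy z0 add0r expr1 -mulrA -expr2 rpredM.
  by rewrite exprMn rpredM.
apply: (extend _ false); rewrite expr0 mulr1; apply: IHr => //.
by rewrite Dy z0 mul0r addr0.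
Qed.

Lemma dim_Fadjoin_sqrt K b :
  b ^+ 2 \in K -> b \notin K -> \dim <<K; b>> = (2 * \dim K)%N.
Proof.
move=> b2 K'b; rewrite dim_Fadjoin; congr (_ * _)%N; apply/eqP.
rewrite eqn_leq; apply/andP; split; last first.
  by rewrite ltn_neqAle eq_sym adjoin_deg_eq1 K'b.
have Kp : ('X^2 - (b ^+ 2)%:P) \is a polyOver K.
  by rewrite rpredB ?polyOverXn ?polyOverC.
have rb : root ('X^2 - (b ^+ 2)%:P) b by rewrite /root !hornerE subrr.
have sz : size ('X^2 - (b ^+ 2)%:P) = 3 by rewrite size_XnsubC.
have := dvdp_leq _ (minPoly_dvdp Kp rb); rewrite -size_poly_gt0 sz size_minPoly.
by apply.
Qed.
End Kummer.

(** * Squares of natural numbers *)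

Section Squares.
Local Open Scope nat_scope.

Definition nat_square (n : nat) := exists s, n = s ^ 2.

Lemma nat_squareM m n : nat_square m -> nat_square n -> nat_square (m * n).
Proof. by case=> s -> [t ->]; exists (s * t); rewrite expnMn. Qed.

Lemma nat_square_div m n : 0 < m -> nat_square m -> nat_square (m * n) -> nat_square n.
Proof.
move=> m0 [s Dm] [t Dt]; rewrite Dm in m0 Dt.
have s0 : 0 < s by move: m0; rewrite expn_gt0 orbF.
have /dvdnP[q Dq] : s %| t by rewrite -(dvdn_pexp2r s t (k := 2)) // -Dt dvdn_mulr.
exists q; apply/eqP; rewrite -(eqn_pmul2l m0) Dt Dq expnMn; apply/eqP; ring.
Qed.

(** Congruence modulo squares is transitive; this serves to replace a number by another one of the
    same class. *)
Lemma nat_square_sub m n k : 0 < m ->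
  nat_square (m * n) -> nat_square (m * k) -> nat_square (n * k).
Proof.
move=> m0 sn sk; apply: (@nat_square_div (m ^ 2)); rewrite ?expn_gt0 ?m0 //.
  by exists m.
have -> : m ^ 2 * (n * k) = (m * n) * (m * k) by ring.
exact: nat_squareM.
Qed.

Lemma odd_logn_nat_square p n : 0 < n -> nat_square n -> ~~ odd (logn p n).
Proof. by move=> n0 [s ->]; rewrite lognX oddM. Qed.
End Squares.

Lemma nat_square_rat n (q : rat) : n%:R = q ^+ 2 -> nat_square n.
Proof.
move=> Dn; have nz_d := denq_neq0 q.
have E : n%:Z * denq q ^+ 2 = numq q ^+ 2.
  apply: (@intr_inj rat); rewrite rmorphM !rmorphXn /= -pmulrn Dn -{1}(divq_num_den q).
  by rewrite expr_div_n mulfVK // expf_neq0 // intr_eq0.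
apply: (@nat_square_div (`|denq q| ^ 2)%N); rewrite ?expn_gt0 ?absz_gt0 ?nz_d //.
  by exists `|denq q|%N.
by exists `|numq q|%N; rewrite -!abszX mulnC -E abszM.
Qed.

(** * Fields generated by square roots of natural numbers *)

Section SquareRootField.
Variables (L : splittingFieldType rat) (r : nat) (a : nat -> nat) (b : nat -> L).
Hypothesis b2 : forall i, (i < r)%N -> b i ^+ 2 = (a i)%:R.
Hypothesis genL : <<1 & mkseq b r>>%VS = fullv.

Lemma prod_sqrt (e : nat -> bool) :
  (\prod_(i < r) b i ^+ e i) ^+ 2 = (\prod_(i < r) a i ^ e i)%:R.
Proof.
rewrite -prodrXl rmorph_prod; apply: eq_bigr => i _ /=.
by rewrite -exprM mulnC exprM b2 // natrX.
Qed.

Lemma sqrt_field_kummer n (y : L) : y ^+ 2 = n%:R ->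
  exists e : nat -> bool, nat_square (n * \prod_(i < r) a i ^ e i).
Proof.
move=> y2; have nat1 (m : nat) : m%:R \in (1%VS : {vspace L}) by apply: rpred_nat.
have [||||e /vlineP[c Dc]] := @adjoin_sqrt_kummer _ L b r y.
- by [].
- by move=> i /b2->.
- by rewrite genL memvf.
- by rewrite y2.
exists e; apply: (@nat_square_rat _ c); apply: (fmorph_inj (in_alg L)) => /=.
rewrite -[LHS]/(in_alg L _) rmorph_nat natrM -y2 -prod_sqrt -exprMn Dc.
by rewrite -[RHS]/(in_alg L _) rmorphXn.
Qed.

Lemma sqrt_field_totally_real : totally_real L.
Proof.
move=> f x.
suff fP : {in <<1 & mkseq b r>>%VS, forall x, f x \is Num.real}.
  by apply: fP; rewrite genL memvf.
apply: adjoin_seq_ind.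
- by move=> c; rewrite alg_num_field fmorph_rat; apply: Creal_Crat; apply: Crat_rat.
- by move=> u v fu fv; rewrite rmorphD rpredD.
- by move=> u v fu fv; rewrite rmorphM rpredM.
- move=> _ /mapP[i + ->]; rewrite mem_iota => /= ltir.
  by rewrite realEsqr -rmorphXn b2 //= rmorph_nat ler0n.
Qed.

Lemma sqrt_field_multiquadratic : multiquadratic L.
Proof.
exists (mkseq b r); split=> //; apply/allP => _ /mapP[i + ->]; rewrite mem_iota => /= ltir.
by rewrite b2 // rpred_nat.
Qed.

Hypothesis indep_a : forall e : nat -> bool,
  nat_square (\prod_(i < r) a i ^ e i) -> forall i, (i < r)%N -> e i = false.

(** Were [b k] in the field of the earlier roots, the Kummer lemma would give a relation modulo
    squares involving [a k]; so every adjunction doubles the degree. *)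
Lemma dim_sqrt_field : \dim {:L} = (2 ^ r)%N.
Proof.
rewrite -genL; have : (r <= r)%N by [].
elim: {1 3 4}r => [|k IHk] lekr; first by rewrite Fadjoin_nil dimv1.
rewrite mkseqS adjoin_rcons dim_Fadjoin_sqrt ?IHk ?expnS ?(ltnW lekr) //=.
  by rewrite b2 ?rpred_nat.
apply/negP => Kb.
have b2' i : (i < k)%N -> b i ^+ 2 \in 1%VS.
  by move=> ltik; rewrite b2 ?rpred_nat // (ltn_trans ltik).
have [||||e] := @adjoin_sqrt_kummer _ L b k (b k).
- by [].
- by [].
- by [].
- by rewrite b2 // rpred_nat.
pose e' i := if (i < k)%N then e i else (i == k).
have prodE (R : comNzRingType) (c : nat -> R) :
    \prod_(i < r) c i ^+ e' i = c k * \prod_(i < k) c i ^+ e i.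
  rewrite (big_ord_widen r (fun i => c i ^+ e i)) ?(ltnW lekr) //.
  rewrite (bigD1 (Ordinal lekr)) //= {1}/e' ltnn eqxx expr1; congr (_ * _).
  rewrite big_mkcond [RHS]big_mkcond; apply: eq_bigr => i _ /=.
  by rewrite -val_eqE /= /e'; case: ltngtP.
rewrite -prodE => /vlineP[c Dc].
have : nat_square (\prod_(i < r) a i ^ e' i).
  apply: (@nat_square_rat _ c); apply: (fmorph_inj (in_alg L)).
  by rewrite rmorph_nat -prod_sqrt Dc -[c%:A]/(in_alg L c) -rmorphXn.
by move/indep_a=> /(_ k lekr); rewrite /e' ltnn eqxx.
Qed.

(** An automorphism is determined by the signs it puts on the [b i], so the Galois group is an
    elementary abelian 2-group, and its order is the degree. *)
Lemma sqrt_field_gal : gal_elem2 L r.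
Proof.
have gen1 (s t : gal_of {:L}) : (forall i, (i < r)%N -> s (b i) = t (b i)) -> s = t.
  move=> st; apply/eqP/gal_eqP => x _.
  suff stP : {in <<1 & mkseq b r>>%VS, forall x, s x = t x}.
    by apply: stP; rewrite genL memvf.
  apply: adjoin_seq_ind.
  - by move=> c; rewrite -[c%:A]/(in_alg L c) !rmorph_alg.
  - by move=> u v su sv; rewrite !rmorphD /= su sv.
  - by move=> u v su sv; rewrite !rmorphM /= su sv.
  - by move=> _ /mapP[i + ->]; rewrite mem_iota => /st.
have sgn (s : gal_of {:L}) i : (i < r)%N -> s (b i) = b i \/ s (b i) = - b i.
  move=> ltir; have /eqP : s (b i) ^+ 2 = b i ^+ 2 by rewrite -rmorphXn b2 //= rmorph_nat.
  by rewrite eqf_sqr => /orP[]/eqP; [left | right].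
have galL : galois 1 {:L}.
  rewrite /galois sub1v normalFieldf andbT; apply/separableP => x _.
  by apply: contraT => /separablePn_pchar[p]; rewrite pchar_lalg pchar_num.
have abel : (2.-abelem 'Gal({:L} / 1))%g.
  apply/abelemP => //; split=> [|s Gs].
    apply/centsP => s _ t _; apply: gen1 => i ltir.
    rewrite !galM ?memvf //.
    by case: (sgn s i ltir) => Es; case: (sgn t i ltir) => Et; rewrite ?Es ?Et ?rmorphN /= ?Es ?Et.
  apply: gen1 => i ltir; rewrite expgS expg1 galM ?memvf // gal_id.
  by case: (sgn s i ltir) => Es; rewrite Es ?rmorphN /= Es ?opprK.
rewrite /gal_elem2 (isog_abelem_card _ abel) mx_Fp_abelem //= cardsT card_mx card_Fp //.
by rewrite mul1n -(galois_dim galL) dimv1 divn1 dim_sqrt_field.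
Qed.
End SquareRootField.

Lemma sqrt_field_exists (r : nat) (a : nat -> nat) :
  exists (L : splittingFieldType rat) (b : nat -> L),
    (forall i, (i < r)%N -> b i ^+ 2 = (a i)%:R) /\ <<1 & mkseq b r>>%VS = fullv.
Proof.
have [L [LC [s Ds genL]]] := num_field_exists (mkseq (fun i => sqrtC (a i)%:R) r).
have szs : size s = r by have := congr1 size Ds; rewrite size_map size_mkseq.
have s2 i : (i < r)%N -> s`_i ^+ 2 = (a i)%:R.
  move=> ltir; apply: (fmorph_inj LC); rewrite rmorphXn /= -(nth_map _ 0) ?szs //.
  by rewrite Ds nth_mkseq // sqrtCK rmorph_nat.
have sq1 z : z \in s -> z ^+ 2 \in (1%VS : {vspace L}).
  by move/(nthP 0)=> [i]; rewrite szs => /s2 E <-; rewrite E rpred_nat.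
(* The product of the [X^2 - z^2] for [z] in [s] has rational coefficients, and its roots are the
   [z] and [- z]. *)
have L_ax : FieldExt_isSplittingField _ L.
  constructor; exists (\prod_(z <- s) ('X^2 - (z ^+ 2)%:P)).
    rewrite big_seq rpred_prod // => z /sq1 z2.
    by rewrite rpredB ?polyOverXn ?polyOverC.
  exists (s ++ map -%R s).
    rewrite big_cat big_map /= -big_split /=.
    rewrite [X in _ %= X](eq_bigr (fun z => 'X^2 - (z ^+ 2)%:P)) ?eqpxx // => z _.
    by rewrite polyCN opprK -subr_sqr rmorphXn.
  apply/eqP; rewrite eqEsubv subvf -genL adjoin_seqSr // => z sz.
  by rewrite mem_cat sz.
exists (HB.pack_for (splittingFieldType rat) L L_ax), (nth 0 s); split=> //.
by rewrite -szs mkseq_nth.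
Qed.

(** * Quadratic units of norm one *)

Section QuadraticUnits.
Variables (L : splittingFieldType rat) (x : nat).
Implicit Type w : L.

Lemma quadratic_alg_int w : w ^+ 2 = x%:R ^+ 2 - 1 -> is_alg_int (x%:R + w).
Proof.
move=> w2; exists ('X^2 - (2 * x)%:R *: 'X + 1); split.
  rewrite -addrA monicE lead_coefDl ?lead_coefXn // size_polyXn ltnS.
  rewrite (leq_trans (size_polyD _ _)) // geq_max size_poly1 size_polyN andbT.
  by rewrite (leq_trans (size_scale_leq _ _)) ?size_polyX.
rewrite /root rmorphD rmorphB /= map_polyZ map_polyXn map_polyX rmorph1 !hornerE.
by rewrite /= sqrrD w2 rmorph_nat natrM; apply/eqP; ring.
Qed.

Variable w : L.
Hypothesis w2 : w ^+ 2 = x%:R ^+ 2 - 1.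

Lemma quadratic_unit_mul : (x%:R + w) * (x%:R - w) = 1.
Proof. by rewrite mulrC -subr_sqr w2; ring. Qed.

Lemma quadratic_unit_sqr : (1 + (x%:R + w)) ^+ 2 = (2 * x.+1)%:R * (x%:R + w).
Proof.
transitivity (1 + 2 * x%:R + x%:R ^+ 2 + 2 * (1 + x%:R) * w + w ^+ 2); first by ring.
by rewrite natrM -natr1 w2; ring.
Qed.

Lemma quadratic_unit_OL : is_unit_OL (x%:R + w).
Proof.
have mul1 := quadratic_unit_mul.
have nz : x%:R + w != 0 by apply: contra_eq_neq mul1 => ->; rewrite mul0r eq_sym oner_neq0.
split=> //; split; first exact: quadratic_alg_int.
have -> : (x%:R + w)^-1 = x%:R + - w by apply: (mulfI nz); rewrite mulfV // mul1.
by apply: quadratic_alg_int; rewrite sqrrN.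
Qed.

(** The images of the unit and of its inverse are real with product 1 and sum [2 * x], so both are
    positive. *)
Lemma quadratic_unit_totally_positive :
  (0 < x)%N -> totally_real L -> totally_positive (x%:R + w).
Proof.
move=> x0 realL f; have mul1 := congr1 f quadratic_unit_mul.
rewrite rmorphM rmorph1 /= in mul1.
have add2 : f (x%:R + w) + f (x%:R - w) = (2 * x)%:R.
  by rewrite -rmorphD /= -(rmorph_nat f); congr (f _); ring.
have : 0 < (2 * x)%:R :> algC by rewrite ltr0n muln_gt0.
rewrite -add2; have := realL f (x%:R + w); have := realL f (x%:R - w).
move: (f _) (f _) mul1 => v u uv1 vR uR uv0; rewrite real_ltNge ?rpred0 //.
apply/negP => u0.
have u_lt0 : u < 0.
  by rewrite lt_neqAle u0 andbT; apply: contra_eq_neq uv1 => ->; rewrite mul0r eq_sym oner_neq0.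
have v_lt0 : v < 0 by rewrite -(nmulr_rgt0 _ u_lt0) uv1 ltr01.
by have := ltrD u_lt0 v_lt0; rewrite addr0 lt_gtF.
Qed.
End QuadraticUnits.

(** The third hypothesis puts the square roots of the [x j ^ 2 - 1] into the field. The fourth
    yields the degree when [t] vanishes, and the independence of the units in general. The last two
    clauses of the conclusion serve to tell fields apart. *)
Lemma good_field_of_numbers (r c : nat) (a : nat -> nat) (x : 'I_c -> nat) :
    (forall i, (i < r)%N -> (0 < a i)%N) -> (forall j, (0 < x j)%N) ->
    (forall j, exists e : nat -> bool,
       nat_square ((x j).-1 * (x j).+1 * \prod_(i < r) a i ^ e i)) ->
    (forall (s : nat -> bool) (t : 'I_c -> bool),
       nat_square ((\prod_j (2 * (x j).+1) ^ t j) * \prod_(i < r) a i ^ s i) ->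
       (forall i, (i < r)%N -> s i = false) /\ (forall j, t j = false)) ->
  exists L : splittingFieldType rat,
    [/\ good_field L r c,
        forall n (y : L), y ^+ 2 = n%:R ->
          exists e : nat -> bool, nat_square (n * \prod_(i < r) a i ^ e i)
      & forall i, (i < r)%N -> exists y : L, y ^+ 2 = (a i)%:R].
Proof.
move=> a0 x0 dx indep; have [L [b [b2 genL]]] := sqrt_field_exists r a.
have kummer := sqrt_field_kummer b2 genL.
have realL := sqrt_field_totally_real b2 genL.
exists L; split=> [|//|i /b2 E]; last by exists (b i).
have natL (n : nat) : (0 < n)%N -> n%:R != 0 :> L.
  by move=> n0; rewrite -(rmorph_nat (in_alg L)) fmorph_eq0 pnatr_eq0 -lt0n.
have /fin_all_exists[w w2] : forall j, exists w : L, w ^+ 2 = (x j)%:R ^+ 2 - 1.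
  move=> j; have [e [z Dz]] := dx j.
  pose B := \prod_(i < r) b i ^+ e i; have DB : B ^+ 2 = _ := prod_sqrt b2 e.
  have nzB : B ^+ 2 != 0.
    by rewrite DB natL // prodn_gt0 // => i; rewrite expn_gt0 a0.
  exists (z%:R / B); rewrite expr_div_n; apply: (canLR (mulfK nzB)).
  have -> : z%:R ^+ 2 = (z ^ 2)%N%:R :> L by rewrite natrX.
  rewrite DB -Dz; have := x0 j; case: (x j) => // k _.
  by rewrite !natrM /= -[k.+2]add2n -[k.+1]add1n !natrD; ring.
pose u j := (x j)%:R + w j.
have uU j : is_unit_OL (u j) /\ totally_positive (u j).
  by split; [exact: quadratic_unit_OL | exact: quadratic_unit_totally_positive].
have indep_u : indep_mod_squares u.
  move=> e [y Dy].
  have nzu : \prod_(i | e i) u i != 0.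
    by rewrite prodf_seq_neq0; apply/allP => j _; rewrite (uU j).1.1 implybT.
  have nzy : y ^+ 2 != 0 by rewrite -Dy.
  (* As [(1 + u j) ^+ 2] is [2 * (x j + 1)] times [u j], dividing the product of the selected
     [1 + u j] by [y] gives a square root of a natural number. *)
  have [|s sq] := kummer (\prod_j (2 * (x j).+1) ^ e j)%N (\prod_(j | e j) (1 + u j) / y).
    rewrite expr_div_n -Dy; apply: (canLR (mulfK nzu)).
    rewrite -prodrXl (eq_bigr _ (fun j _ => quadratic_unit_sqr (w2 j))) big_split /=.
    congr (_ * _); rewrite natr_prod [LHS]big_mkcond; apply: eq_bigr => j _.
    by rewrite natrX; case: (e j).
  by have [_] := indep s e sq.
split=> //.
- exact: sqrt_field_multiquadratic b2 genL.
- apply: sqrt_field_gal b2 genL _ => s sq.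
  by have [] := indep s xpred0 _; rewrite // big1 ?mul1n.
- by exists u.
- by exists u; split=> // e [y [_ Dy]]; apply: indep_u; exists y.
Qed.

(** * Infinitely many fields from arithmetic data *)

Lemma logn_prod (I : Type) (s : seq I) (P : pred I) (F : I -> nat) p :
    (forall i, P i -> 0 < F i)%N ->
  logn p (\prod_(i <- s | P i) F i) = (\sum_(i <- s | P i) logn p (F i))%N.
Proof.
move=> F0; elim: s => [|i s IHs]; first by rewrite !big_nil logn1.
by rewrite !big_cons; case: ifP => // Pi; rewrite lognM ?F0 ?IHs // prodn_cond_gt0 //.
Qed.

Definition unit_numbers (r c : nat) (a : nat -> nat) (x : 'I_c -> nat) :=
  [/\ forall i, (i < r)%N -> (0 < a i)%N, forall j, (0 < x j)%N,
      forall j, exists e : nat -> bool,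
        nat_square ((x j).-1 * (x j).+1 * \prod_(i < r) a i ^ e i)
    & forall (s : nat -> bool) (t : 'I_c -> bool),
        nat_square ((\prod_j (2 * (x j).+1) ^ t j) * \prod_(i < r) a i ^ s i) ->
        (forall i, (i < r)%N -> s i = false) /\ (forall j, t j = false)].

(** If a number becomes a square in the field, a prime of odd valuation in it divides some [a i]. So
    each field admits a bound on such primes, and a field in which a larger one occurs is new. [P]
    records that bound together with such a prime above [B]. *)
Lemma infinitely_many_of_numbers (r c : nat) : (0 < r)%N ->
    (forall B, exists a x, @unit_numbers r c a x /\
       exists q, [/\ prime q, (B < q)%N & odd (logn q (a 0%N))]) ->
  infinitely_many_good r c.
Proof.
move=> r0 ex.
pose P B (Ln : splittingFieldType rat * nat) :=
  [/\ good_field Ln.1 r c,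
      exists2 q, (B < q)%N /\ prime q & exists y : Ln.1, exists2 n, y ^+ 2 = n%:R & odd (logn q n)
    & forall q n (y : Ln.1), (Ln.2 < q)%N -> y ^+ 2 = n%:R -> ~~ odd (logn q n)].
have /functional_choice[G GP] : forall B, exists Ln, P B Ln.
  move=> B; have [a [x [[a0 x0 dx indep] [q [pr_q Bq odd_q]]]]] := ex B.
  have [L [gL kummer sqrt_a]] := good_field_of_numbers a0 x0 dx indep.
  exists (L, (\prod_(i < r) a i)%N); split=> //=.
    by have [y Dy] := sqrt_a 0%N r0; exists q => //; exists y, (a 0%N).
  move=> p n y ltp /kummer[e sq]; apply/negP => odd_p.
  have n0 : (0 < n)%N by case: n odd_p {sq} => //; rewrite logn0.
  have e0 : (0 < \prod_(i < r) a i ^ e i)%N by rewrite prodn_gt0 // => i; rewrite expn_gt0 a0.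
  have := odd_logn_nat_square p _ sq; rewrite muln_gt0 n0 e0 lognM // => /(_ isT).
  rewrite logn_prod => [|i _]; last by rewrite expn_gt0 a0.
  rewrite big1 ?addn0 ?odd_p // => i _; rewrite lognX ltn_log0 ?muln0 //.
  apply: leq_ltn_trans ltp; rewrite (bigD1 i) //= leq_pmulr // prodn_gt0 // => k.
  exact: a0.
(* [B k] dominates the bounds of all fields before the [k]-th, so the prime of the [k]-th field
   cannot occur in them. *)
pose B := fix B k := if k is k'.+1 then maxn (B k') (G (B k')).2 else 0%N.
have leB i j : (i < j)%N -> ((G (B i)).2 <= B j)%N.
  elim: j => // j IHj; rewrite ltnS leq_eqVlt => /orP[/eqP->|/IHj]; rewrite /= leq_max ?leqnn ?orbT //.
  by move->.
exists (fun k => (G (B k)).1); split=> [i|]; first by have [] := GP (B i).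
have noiso i j : (i < j)%N -> {rmorphism (G (B j)).1 -> (G (B i)).1} -> False.
  move=> ltij f; have [_ [q [ltq _] [y [n Dy odd_n]]] _] := GP (B j).
  have [_ _ even] := GP (B i).
  have := even q n (f y) (leq_ltn_trans (leB _ _ ltij) ltq).
  by rewrite odd_n -rmorphXn Dy rmorph_nat => /(_ erefl).
move=> i j neq [f [g fK gK]]; case: (ltngtP i j) neq => // [ltij|ltji] _; last exact: noiso ltji f.
(* Only morphisms from a later field to an earlier one have been refuted, so in this case the
   inverse map must be made a morphism. *)
have gB : zmod_morphism g by exact: can2_zmod_morphism fK gK.
have gM : monoid_morphism g by exact: can2_monoid_morphism fK gK.
pose g1 := GRing.isZmodMorphism.Build _ _ g gB.
pose g2 := GRing.isMonoidMorphism.Build _ _ g gM.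
exact: noiso ltij (HB.pack g g1 g2 : {rmorphism _ -> _}).
Qed.

Lemma crt (s : seq (nat * nat)) :
    pairwise (fun u v => coprime u.1 v.1) s ->
  exists M, {in s, forall u, M = u.2 %[mod u.1]}.
Proof.
elim: s => [|[m x] s IHs] /=; first by exists 0%N.
case/andP=> co /IHs[M DM]; set Q := (\prod_(u <- s) u.1)%N.
have coQ : coprime m Q.
  rewrite /Q; elim: s co {IHs DM Q} => [|u s IHs] /=; first by rewrite big_nil coprimen1.
  by case/andP=> cu /IHs; rewrite big_cons coprimeMr cu.
exists (chinese m Q x M) => u; rewrite inE => /orP[/eqP-> | su]; first exact: chinese_modl.
have dvdQ : (u.1 %| Q)%N by rewrite /Q (big_rem u) //= dvdn_mulr.
by rewrite -DM // -(modn_dvdm _ dvdQ) chinese_modr // modn_dvdm.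
Qed.

(** * Numbers divisible by their differences *)

Section DividingDifferences.
Local Open Scope nat_scope.

Lemma prime_sequence B : exists p : nat -> nat,
  [/\ forall k, prime (p k), forall k, B < p k & injective p].
Proof.
pose f m := s2val (prime_above m).
have f_pr m : prime (f m) by apply: (s2valP' (prime_above m)).
have ltf m : m < f m by apply: (s2valP (prime_above m)).
have mono k m : iter m f B < iter (k.+1 + m) f B.
  by elim: k => [|k IHk]; [exact: ltf | exact: ltn_trans IHk (ltf _)].
exists (fun k => iter k.+1 f B); split=> [k|k|i j].
- exact: f_pr.
- by have := mono k 0; rewrite addn0.
have lt_neq m n : m < n -> iter m.+1 f B <> iter n.+1 f B.
  by move=> ltmn E; have := mono (n - m.+1) m.+1; rewrite E addSn subnK // ltnn.
by case: (ltngtP i j) => // [/lt_neq// | /lt_neq neq /esym].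
Qed.

(** The congruence by which the Chinese remainder theorem imposes exact divisibility by [p]. *)
Lemma logn_prime_mod p n : prime p -> n = p %[mod p ^ 2] -> logn p n = 1.
Proof.
move=> pr_p Dn; have p_gt0 := prime_gt0 pr_p.
have pp2 : p %| p ^ 2 by apply: dvdn_exp.
have dvd1 : p %| n by rewrite /dvdn -(modn_dvdm n pp2) Dn modn_dvdm // modnn.
have ndvd2 : ~~ (p ^ 2 %| n).
  by rewrite /dvdn Dn modn_small -?lt0n // ltn_Pmulr ?prime_gt1.
have n0 : 0 < n by case: (n) ndvd2 => //; rewrite dvdn0.
apply/eqP; rewrite eqn_leq -(pfactor_dvdn 1 pr_p n0) expn1 dvd1 andbT.
by rewrite leqNgt -(pfactor_dvdn 2 pr_p n0).
Qed.

(** The valuation at [p k] sees only [l k], so it reads off the parity of [e k]; the even powers are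
    then divided out. *)
Lemma nat_square_detect n (l e p : nat -> nat) m : 0 < m ->
    (forall i, i < n -> 0 < l i) ->
    (forall i k, i < n -> k < n -> logn (p k) (l i) = (i == k)) ->
    (forall k, k < n -> logn (p k) m = 0) ->
    nat_square ((\prod_(i < n) l i ^ e i) * m) ->
  (forall i, i < n -> ~~ odd (e i)) /\ nat_square m.
Proof.
move=> m0 l0 pl pm sq.
have le0 (i : 'I_n) : 0 < l i ^ e i by rewrite expn_gt0 l0.
have even_e k : k < n -> ~~ odd (e k).
  move=> ltkn; have := odd_logn_nat_square (p k) _ sq.
  rewrite muln_gt0 m0 prodn_gt0 // lognM ?prodn_gt0 // pm // addn0 logn_prod // => /(_ isT).
  rewrite (bigD1 (Ordinal ltkn)) //= big1 => [|i /negPf neq].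
    by rewrite addn0 lognX pl // eqxx muln1.
  by rewrite lognX pl // -[i == k :> nat]/(i == Ordinal ltkn) neq muln0.
split=> //; apply: nat_square_div sq; first by rewrite prodn_gt0.
exists (\prod_(i < n) l i ^ (e i)./2); rewrite (big_morph (expn^~ 2) (fun x y => expnMn x y 2) (exp1n 2)).
apply: eq_bigr => i _.
by rewrite -expnM muln2 halfK (negPf (even_e i _)) // subn0.
Qed.

(** The factor [(i < j)] gives exponent 0 to the truncated differences of the other pairs. *)
Definition family_monomial (l : nat -> nat) n (e : nat -> nat) (f : nat -> nat -> nat) :=
  (\prod_(i < n) l i ^ e i) * \prod_(j < n) \prod_(i < n) (l j - l i) ^ ((i < j) * f i j).

Definition independent_family (l : nat -> nat) n :=
  forall e f, nat_square (family_monomial l n e f) ->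
    (forall i, i < n -> ~~ odd (e i)) /\ (forall i j, i < j -> j < n -> ~~ odd (f i j)).

(* Induction step: replace l_0, ..., l_(n-1) by N, N + l_0, ..., N + l_(n-1)
   with N a multiple of all the l_i and all their differences. *)
Lemma dividing_differences n B : exists l : nat -> nat,
  [/\ forall i, i < n.+1 -> 0 < l i,
      forall i j, i < j -> j < n.+1 -> l i < l j /\ (l j - l i) %| l i,
      independent_family l n.+1
    & exists2 q, prime q & B < q /\ forall i, i < n.+1 -> logn q (l i) = (i == 0)].
Proof.
elim: n => [|n [l [l0 dvd_l ind_l _]]].
  have [p Bp pr_p] := prime_above B.
  exists (fun=> p); split=> [i _|[|i] [|j]|e f|] //; first exact: prime_gt0.
    rewrite /family_monomial !big_ord1 muln1 => sq; split=> [[|//] _|i [|//]//].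
    have := odd_logn_nat_square p _ sq; rewrite pfactorK //; apply.
    by rewrite expn_gt0 prime_gt0.
  by exists p => //; split=> // -[|//] _; rewrite (pfactorK 1).
pose D := \prod_(j < n.+1) \prod_(i < n.+1 | i < j) (l j - l i).
pose Q := (\prod_(i < n.+1) l i) * D.
have D0 : 0 < D.
  rewrite prodn_gt0 // => j; rewrite prodn_cond_gt0 // => i ltij.
  by rewrite subn_gt0; have [] := dvd_l i j ltij (ltn_ord j).
have Q0 : 0 < Q by rewrite muln_gt0 D0 prodn_gt0 // => i; apply: l0.
have l_dvd i : i < n.+1 -> l i %| Q.
  by move=> lti; rewrite dvdn_mulr // (bigD1 (Ordinal lti)) //= dvdn_mulr.
have d_dvd i j : i < j -> j < n.+1 -> (l j - l i) %| Q.
  move=> ltij ltj; rewrite dvdn_mull // /D (bigD1 (Ordinal ltj)) //= dvdn_mulr //.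
  by rewrite (bigD1 (Ordinal (ltn_trans ltij ltj))) //= dvdn_mulr.
have [p [pr_p ltBp inj_p]] := prime_sequence (maxn B Q).
have ltQp k : Q < p k by apply: leq_ltn_trans (ltBp k); apply: leq_maxr.
pose off k := if k is k'.+1 then l k' else 0.
have off_le k : k < n.+2 -> off k <= Q.
  by case: k => //= k ltk; apply: dvdn_leq => //; apply: l_dvd.
(* [N] is to vanish modulo [Q], and [N + off k] is to be [p k] modulo [p k ^ 2], so that [p k]
   divides it exactly once. *)
pose mods := (Q, 0) :: [seq (p k ^ 2, p k ^ 2 + p k - off k) | k <- iota 0 n.+2].
have [|N DN] := @crt mods.
  rewrite pairwise_cons all_map pairwise_map; apply/andP; split.
    apply/allP => k _ /=; rewrite coprime_sym coprime_pexpl // prime_coprime //.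
    by apply/negP => /(dvdn_leq Q0); rewrite leqNgt ltQp.
  apply/(pairwiseP 0) => i j; rewrite !inE size_iota => lti ltj ltij.
  rewrite !nth_iota // /= coprime_pexpl // coprime_pexpr // prime_coprime // dvdn_prime2 //.
  by apply/eqP => /inj_p/eqP; rewrite !add0n ltn_eqF.
have NQ : Q %| N by rewrite /dvdn (DN (Q, 0)) ?mem_head ?mod0n.
pose l' k := N + off k.
have Dl' k : k < n.+2 -> logn (p k) (l' k) = 1.
  move=> ltk; apply: logn_prime_mod => //.
  have Np : N = p k ^ 2 + p k - off k %[mod p k ^ 2].
    by apply: (DN (_, _)); rewrite inE; apply/orP; right; apply/mapP; exists k; rewrite ?mem_iota.
  rewrite /l' -modnDml Np modnDml subnK ?modnDl //.
  by rewrite (leq_trans (off_le k ltk)) // (leq_trans (ltnW (ltQp k))) ?leq_addl.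
have l'0 k : k < n.+2 -> 0 < l' k.
  by move/Dl'; case: (l' k) => //; rewrite logn0.
have diff i j : i < j -> j < n.+2 -> [/\ l' i < l' j, l' j - l' i %| l' i & l' j - l' i <= Q].
  case: j => // j ltij ltj; rewrite /l' subnDl ltn_add2l /=.
  case: i ltij => [|i] ltij /=.
    have ld := l_dvd j ltj; rewrite subn0 addn0; split; first exact: l0.
      exact: dvdn_trans ld NQ.
    exact: dvdn_leq ld.
  have [ltl dvdl] := dvd_l i j ltij ltj.
  have dd := d_dvd i j ltij ltj; split=> //; last exact: dvdn_leq dd.
  by apply: dvdn_add => //; apply: dvdn_trans dd NQ.
(* Two members differ by at most [Q < p k], so [p k] cannot divide both. *)
have pl' i k : i < n.+2 -> k < n.+2 -> logn (p k) (l' i) = (i == k).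
  move=> lti ltk; have [->|neq] := eqVneq i k; first exact: Dl'.
  have pk : p k %| l' k.
    by rewrite -[p k]expn1 pfactor_dvdn ?Dl' ?l'0.
  apply/eqP; rewrite -leqn0 leqNgt logn_gt0 mem_primes pr_p l'0 //=.
  apply/negP => pi; have [ltik|ltki|/eqP] := ltngtP i k; last by rewrite (negPf neq).
    have [lt_l _ leQ] := diff i k ltik ltk.
    have := dvdn_leq _ (dvdn_sub pk pi); rewrite subn_gt0 lt_l => /(_ isT).
    by rewrite leqNgt (leq_ltn_trans leQ).
  have [lt_l _ leQ] := diff k i ltki lti.
  have := dvdn_leq _ (dvdn_sub pi pk); rewrite subn_gt0 lt_l => /(_ isT).
  by rewrite leqNgt (leq_ltn_trans leQ).
exists l'; split=> // [i j ltij ltj|e f sq|]; first by have [] := diff i j ltij ltj.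
  have := sq; rewrite /family_monomial; set m := (X in nat_square (_ * X)) => sqm.
  (* The differences of the new family are the old [l i], from pairs containing index 0, and the old
     differences, so the induction hypothesis applies to [m]. *)
  have Dm : m = family_monomial l n.+1 (fun i => f 0 i.+1) (fun i j => f i.+1 j.+1).
    rewrite /m /family_monomial big_ord_recl /= big1 ?mul1n; last first.
      by move=> i _.
    rewrite -big_split /=; apply: eq_bigr => j _.
    rewrite big_ord_recl /= /bump /= !add1n mul1n /l' /= addn0 addKn; congr (_ * _).
    by apply: eq_bigr => i _; rewrite !add1n subnDl ltnS.
  have d0 (i j : 'I_n.+2) : 0 < (l' j - l' i) ^ ((i < j) * f i j).
    rewrite expn_gt0; case: (ltnP i j) => [ltij|_]; last by rewrite mul0n eqxx orbT.
    by rewrite subn_gt0; have [->] := diff _ _ ltij (ltn_ord j).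
  have m0 : 0 < m by rewrite prodn_gt0 // => j; rewrite prodn_gt0.
  have pm k : k < n.+2 -> logn (p k) m = 0.
    move=> ltk; rewrite logn_prod => [|j _]; last by rewrite prodn_gt0.
    rewrite big1 // => j _; rewrite logn_prod // big1 // => i _; rewrite lognX.
    case: (ltnP i j) => [ltij|_]; last by rewrite !mul0n.
    have [_ _ leQ] := diff i j ltij (ltn_ord j).
    by rewrite ltn_log0 ?muln0 // (leq_ltn_trans leQ).
  have [even_e sq'] := nat_square_detect m0 l'0 pl' pm sqm.
  split=> // i j ltij ltj; rewrite Dm in sq'; have [ev0 ev] := ind_l _ _ sq'.
  by case: j ltij ltj => // j; case: i => [|i] ltij ltj; [exact: (ev0 j) | exact: (ev i j)].
exists (p 0) => //; split=> [|i lti]; last exact: pl'.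
by apply: leq_ltn_trans (ltBp 0); apply: leq_maxl.
Qed.
End DividingDifferences.

(** * Units from pairs of the family *)

Section FamilyUnits.
Local Open Scope nat_scope.
Variables (n : nat) (l : nat -> nat).
Hypothesis dvd_l : forall i j, i < j -> j < n.+1 -> l i < l j /\ (l j - l i) %| l i.

Definition pair_unit (i j : nat) := 2 * (l j %/ (l j - l i)) - 1.

(** With [x = 2 k + 1], [x^2 - 1] is [4 k (k + 1)], the class of [l i * l j], and [2 (x + 1)] is
    [4 (k + 1)], the class of [l j * d]. *)
Lemma pair_unit_spec i j : i < j -> j < n.+1 -> exists d k,
  [/\ 0 < d, l j - l i = d, l j = d * k.+1, l i = d * k & pair_unit i j = (2 * k).+1].
Proof.
move=> ltij ltj; have [ltl /dvdnP[k Dk]] := dvd_l ltij ltj.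
have d0 : 0 < l j - l i by rewrite subn_gt0.
have Dlj : l j = (l j - l i) * k.+1 by rewrite mulnS mulnC -Dk subnK // ltnW.
exists (l j - l i), k; split=> //; last by rewrite /pair_unit {1}Dlj mulKn // mulnS subn1.
by rewrite mulnC.
Qed.

Definition family_gen k := l 0 * l k.+1.

(** [l 0] occurs in every generator, so its exponent counts the selected ones. *)
Definition gen_exponent (s : nat -> bool) (i : nat) : nat :=
  if i is i'.+1 then s i' : nat else \sum_(k < n) s k.

Lemma family_gen_prod (s : nat -> bool) :
  \prod_(k < n) family_gen k ^ s k =
  \prod_(i < n.+1) l i ^ gen_exponent s i.
Proof.
rewrite big_ord_recl /= expn_sum -big_split /=; apply: eq_bigr => k _.
by rewrite expnMn.
Qed.

Lemma pair_unit_sqrt i j : i < j -> j < n.+1 -> exists e : nat -> bool,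
  nat_square ((pair_unit i j).-1 * (pair_unit i j).+1 * \prod_(k < n) family_gen k ^ e k).
Proof.
move=> ltij ltj; have [d [k [d0 _ Dlj Dli ->]]] := pair_unit_spec ltij ltj.
(* Modulo squares [l i * l j] is the product of the generators [l 0 * l i] and [l 0 * l j]; for
   [i = 0] only the second is taken. *)
pose e m := (m.+1 == i) || (m.+1 == j); exists e.
apply: (@nat_square_div (d ^ 2)); first by rewrite expn_gt0 d0.
  by exists d.
have -> : d ^ 2 * ((2 * k).+1.-1 * (2 * k).+2 * \prod_(k < n) family_gen k ^ e k)
    = 2 ^ 2 * (l j * l i * \prod_(k < n) family_gen k ^ e k).
  by rewrite Dlj Dli /=; ring.
apply: nat_squareM; first by exists 2.
have [i' [j' [Di Dj]]] : exists i' j' : nat, i = i' /\ j = j'.+1.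
  by exists i, j.-1; rewrite prednK // (leq_ltn_trans _ ltij).
have ltj' : j' < n by rewrite Dj in ltj.
rewrite (bigD1 (Ordinal ltj')) //= {1}/e Dj eqxx orbT expn1 /family_gen.
case: i ltij Di @e {Dli} => [|i] ltij Di e.
  rewrite big1 => [|m /negPf neq]; last first.
    by rewrite /e Dj eqSS -[m == j' :> nat]/(m == Ordinal ltj') neq.
  by exists (l j'.+1 * l 0); ring.
have lti : i < n by rewrite (ltn_trans _ ltj') // -ltnS -Dj.
have neqij : Ordinal lti != Ordinal ltj' by rewrite -val_eqE /= neq_ltn -ltnS -Dj ltij.
rewrite (bigD1 (Ordinal lti)) //= {1}/e eqxx expn1 big1 => [|m /andP[/negPf neqj /negPf neqi]].
  by exists (l j'.+1 * l i.+1 * l 0); ring.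
rewrite /e Dj !eqSS -[m == j' :> nat]/(m == Ordinal ltj') neqj.
by rewrite -[m == i :> nat]/(m == Ordinal lti) neqi.
Qed.

Lemma pair_unit_class i j : i < j -> j < n.+1 ->
  nat_square ((2 * (pair_unit i j).+1) * (l j * (l j - l i))).
Proof.
move=> ltij ltj; have [d [k [d0 -> -> _ ->]]] := pair_unit_spec ltij ltj.
by exists (2 * d * k.+1); ring.
Qed.
End FamilyUnits.

Section FamilyUnitNumbers.
Local Open Scope nat_scope.
Variables (n c : nat) (l : nat -> nat) (pr : 'I_c -> nat * nat).
Hypothesis l0 : forall i, i < n.+1 -> 0 < l i.
Hypothesis dvd_l : forall i j, i < j -> j < n.+1 -> l i < l j /\ (l j - l i) %| l i.
Hypothesis pr_lt : forall h, (pr h).1 < (pr h).2.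
Hypothesis pr_ltn : forall h, (pr h).2 < n.+1.

Lemma pair_units_class (t : 'I_c -> bool) m :
    nat_square ((\prod_h (2 * (pair_unit l (pr h).1 (pr h).2).+1) ^ t h) * m) ->
  nat_square ((\prod_h (l (pr h).2 * (l (pr h).2 - l (pr h).1)) ^ t h) * m).
Proof.
apply: nat_square_sub; first by rewrite prodn_gt0 // => h; rewrite expn_gt0.
rewrite -big_split /=; apply: (big_ind nat_square); first by exists 1.
  exact: nat_squareM.
move=> h _; case: (t h); rewrite /= ?expn0 ?expn1; last by exists 1.
exact: (pair_unit_class dvd_l (pr_lt h) (pr_ltn h)).
Qed.

Hypothesis pr_inj : injective pr.
Hypothesis ind_l : independent_family l n.+1.

(** Distinct units come from distinct pairs, so the exponents of the differences isolate the [t h];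
    after that, the exponent of [l i.+1] is [s i]. *)
Lemma family_unit_numbers :
  @unit_numbers n c (family_gen l) (fun h => pair_unit l (pr h).1 (pr h).2).
Proof.
split=> [i lti|h|h|s t /pair_units_class sq].
- by rewrite muln_gt0 !l0.
- by have [d [k [_ _ _ _ ->]]] := pair_unit_spec dvd_l (pr_lt h) (pr_ltn h).
- exact: (pair_unit_sqrt dvd_l (pr_lt h) (pr_ltn h)).
pose F i j := \sum_(h | pr h == (i, j)) t h.
pose G i := \sum_(h | (pr h).2 == i) t h.
have {}sq : nat_square (family_monomial l n.+1 (fun i => G i + gen_exponent n s i) F).
  move: sq; rewrite family_gen_prod.
  have -> : \prod_h (l (pr h).2 * (l (pr h).2 - l (pr h).1)) ^ t h =
      (\prod_(i < n.+1) l i ^ G i) * \prod_(j < n.+1) \prod_(i < n.+1) (l j - l i) ^ ((i < j) * F i j).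
    rewrite (eq_bigr _ (fun h _ => expnMn _ _ _)) big_split /=; congr (_ * _).
      rewrite (partition_big (fun h => Ordinal (pr_ltn h)) xpredT) //=.
      apply: eq_bigr => i _; rewrite /G expn_sum; apply: eq_big => // h /eqP <-.
      by [].
    rewrite pair_big /= (partition_big (fun h => (Ordinal (pr_ltn h),
       Ordinal (ltn_trans (pr_lt h) (pr_ltn h)))) xpredT) //=.
    apply: eq_bigr => -[j i] _ /=.
    have -> : (i < j) * F i j = F i j.
      case: ltnP => [|leji]; rewrite ?mul1n // mul0n /F big_pred0 // => h.
      by apply/eqP => E; have := pr_lt h; rewrite E ltnNge leji.
    rewrite /F expn_sum; apply: eq_big => [h|h /eqP[<- <-]] //.
    by case: (pr h) (pr_lt h) (pr_ltn h) => u v ? ?; rewrite !xpair_eqE -!val_eqE /= andbC.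
  rewrite mulnAC /family_monomial -big_split /=.
  by under eq_bigr => i _ do rewrite -expnD.
have [even_e even_f] := ind_l sq.
have t0 h : t h = false.
  have := even_f _ _ (pr_lt h) (pr_ltn h); rewrite /F (bigD1 h) /=; last by case: (pr h).
  rewrite big1 ?addn0 => [|h' /andP[/eqP E /eqP]]; first by case: (t h).
  by case; apply: pr_inj; rewrite E; case: (pr h).
split=> // i lti; have := even_e i.+1 lti; rewrite /G big1 => [|h _]; last by rewrite t0.
by rewrite add0n /=; case: (s i).
Qed.
End FamilyUnitNumbers.

Lemma pair_enumeration n c : (c <= 'C(n, 2))%N ->
  exists pr : 'I_c -> nat * nat,
    [/\ forall h, ((pr h).1 < (pr h).2)%N, forall h, ((pr h).2 < n)%N & injective pr].
Proof.
move=> lec; pose A := [set p : 'I_n * 'I_n | (p.1 < p.2)%N].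
have cardA : #|A| = 'C(n, 2).
  rewrite -bin2_sum big_mkord -sum1_card big_mkcond.
  rewrite (eq_bigr (fun p : 'I_n * 'I_n => (p.1 < p.2)%N : nat)); last first.
    by move=> p _; rewrite inE; case: ifP.
  rewrite -(pair_bigA _ (fun i j : 'I_n => (i < j)%N : nat)) exchange_big /=.
  apply: eq_bigr => j _.
  rewrite -[RHS]card_ord -sum1_card (big_ord_widen n (fun=> 1%N)) 1?ltnW //.
  by rewrite [RHS]big_mkcond; apply: eq_bigr => i _; case: ltnP.
have lecA : (c <= #|A|)%N by rewrite cardA.
pose p h := enum_val (widen_ord lecA h).
have Ap h : p h \in A by apply: enum_valP.
exists (fun h => ((p h).1 : nat, (p h).2 : nat)); split=> [h|h|h h' []] //=.
  by have := Ap h; rewrite inE.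
move=> E1 E2; have : p h = p h' by apply/eqP; rewrite -pair_eqE /= -!val_eqE /= E1 E2 !eqxx.
by move/enum_val_inj/(congr1 val) => /= /val_inj.
Qed.

Lemma infinitely_many_of_pairs n c : (0 < n)%N -> (c <= 'C(n.+1, 2))%N ->
  infinitely_many_good n c.
Proof.
move=> n0 /pair_enumeration[pr [pr_lt pr_ltn pr_inj]].
apply: infinitely_many_of_numbers => // B.
have [l [l0 dvd_l ind_l [q pr_q [ltBq lq]]]] := dividing_differences n B.
exists (family_gen l), (fun h => pair_unit l (pr h).1 (pr h).2); split.
  exact: family_unit_numbers.
(* [q] divides [l 0] exactly once and does not divide [l 1]. *)
exists q; split=> //; by rewrite /family_gen lognM ?l0 // ?ltnS // !lq.
Qed.

(** * Pell's equation *)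

Section Pell.
Local Open Scope nat_scope.
Variables d r : nat.
Hypotheses (r0 : 0 < r) (ltrd : r ^ 2 < d) (ltdr : d < r.+1 ^ 2).

(** [(P, Q)] encodes the complete quotient [(P + sqrt d) / Q] of a continued fraction, [r] being the
    integer part of [sqrt d]. The inequalities say that it exceeds 1 and that its conjugate lies
    between -1 and 0. *)
Definition pell_reduced (s : nat * nat) :=
  [/\ 0 < s.1, s.1 <= r, r < s.1 + s.2, s.2 <= r + s.1 & s.2 %| d - s.1 ^ 2].

Definition pell_quotient (s : nat * nat) := (r + s.1) %/ s.2.
(** Subtracting the partial quotient and inverting gives the next complete quotient. *)
Definition pell_step (s : nat * nat) :=
  let P := pell_quotient s * s.2 - s.1 in (P, (d - P ^ 2) %/ s.2).

Lemma pell_stepP s : pell_reduced s ->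
  [/\ pell_reduced (pell_step s), 0 < pell_quotient s,
      (pell_step s).1 + s.1 = pell_quotient s * s.2
    & s.2 * (pell_step s).2 + (pell_step s).1 ^ 2 = d].
Proof.
case: s => P Q [/= P0 lePr ltrPQ leQ dvdQ]; have Q0 : 0 < Q by lia.
rewrite /pell_step /pell_quotient /=; set a := (r + P) %/ Q.
have lea : a * Q <= r + P by apply: leq_divM.
have lta : r + P < a * Q + Q by rewrite -mulSnr ltn_ceil.
have a0 : 0 < a by rewrite divn_gt0.
have lePa : P < a * Q by nia.
set P' := a * Q - P; have EP : P' + P = a * Q by rewrite subnK // ltnW.
have leP'r : P' <= r by lia.
have leP'd : P' ^ 2 < d by apply: leq_ltn_trans ltrd; rewrite leq_exp2r.
have P'0 : 0 < P' by rewrite subn_gt0.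
have dvdQ' : Q %| d - P' ^ 2.
  have lePd : P ^ 2 <= d by apply: ltnW; apply: leq_ltn_trans ltrd; rewrite leq_exp2r.
  have /dvdnP[k Dk] := dvdQ.
  have E : (d - P' ^ 2) + a * Q * P' = (d - P ^ 2) + a * Q * P.
    rewrite -EP; nia.
  by rewrite -(dvdn_addl _ (n := a * Q * P')) ?E ?dvdn_add // -mulnA dvdn_mull ?dvdn_mulr.
have EQ : Q * ((d - P' ^ 2) %/ Q) + P' ^ 2 = d by rewrite mulnC divnK // subnK // ltnW.
set Q' := _ %/ Q in EQ *.
have leQa : Q <= a * Q by rewrite leq_pmull.
(* Both bounds on [Q'] compare [Q * Q' = d - P' ^ 2] with a product: if the first fails it is at
   most [r ^ 2 - P' ^ 2], if the second fails at least [r.+1 ^ 2 - P' ^ 2]. *)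
have [w Dw] : exists w, r = P' + w by exists (r - P'); rewrite subnKC.
split=> //; split=> //=.
- rewrite ltnNge; apply/negP => leQ'.
  have := leq_mul (_ : Q <= 2 * P' + w) (_ : Q' <= w) => /(_ ltac:(lia) ltac:(lia)).
  move: ltrd EQ; rewrite Dw !expnS !expn0; lia.
- rewrite leqNgt; apply/negP => ltQ'.
  have := leq_mul (_ : w.+1 <= Q) (_ : (2 * P' + w).+1 <= Q') => /(_ ltac:(lia) ltac:(lia)).
  move: ltdr EQ; rewrite Dw !expnS !expn0; lia.
- by rewrite -EQ addnK dvdn_mull.
Qed.

(** The image determines [Q] through the product relation. Then [P] is known modulo [Q], and it lies
    in the window of length [Q] ending at [r]. *)
Lemma pell_step_inj s t :
  pell_reduced s -> pell_reduced t -> pell_step s = pell_step t -> s = t.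
Proof.
move=> rs rt Est; have := pell_stepP rs; have := pell_stepP rt; rewrite -Est.
move: (pell_step s) => [R S] {Est}; case: s t rs rt => P Q [P' Q'] /=.
move=> [/= P0 lePr ltrPQ _ _] [/= P'0 leP'r ltrPQ' _ _].
move=> [[/= R0 leRr ltrRS leS _] a0 Ea EQ] [_ b0 Eb EQ'].
have S0 : 0 < S by lia.
have EQQ : Q = Q'.
  by apply/eqP; rewrite -(eqn_pmul2r S0) -(eqn_add2r (R ^ 2)) EQ EQ'.
move: (pell_quotient _) (pell_quotient _) Ea Eb {a0 b0} => a b Ea Eb.
rewrite -{Q' EQ}EQQ in ltrPQ' Ea *; congr (_, _).
have [lt_ab|lt_ba|eq_ab] := ltngtP a b.
- have := leq_mul lt_ab (leqnn Q); rewrite mulSn; lia.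
- have := leq_mul lt_ba (leqnn Q); rewrite mulSn; lia.
- by apply: (@addnI R); rewrite Ea Eb ?eq_ab.
Qed.

(* The element p + q sqrt d of norm +-Q runs through the convergents; u + v sqrt d
   is its predecessor, recovered as (p + q sqrt d)(sqrt d - P) / Q. *)
Definition pell_invariant (s : nat * nat) := exists p q u v : int,
  [/\ (0 <= q)%R, (0 <= v)%R, (0 < q + v)%R,
      [/\ p - q * s.1%:Z = s.2%:Z * v & q * d%:Z - p * s.1%:Z = s.2%:Z * u]%R
    & (p ^+ 2 - d%:Z * q ^+ 2 = s.2%:Z \/ p ^+ 2 - d%:Z * q ^+ 2 = - s.2%:Z)%R].

(** The new element is [p + q sqrt d] times [(sqrt d + P') / Q]; as [P'^2 - d = - Q Q'], its norm is
    [Q'] up to sign. *)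
Lemma pell_invariant_step s : pell_reduced s -> pell_invariant s ->
  exists p q : int, [/\ (0 < q)%R, (p ^+ 2 - d%:Z * q ^+ 2 = (pell_step s).2%:Z \/
     p ^+ 2 - d%:Z * q ^+ 2 = - (pell_step s).2%:Z)%R & pell_invariant (pell_step s)].
Proof.
move=> rs [p [q [u [v [q0 v0 qv0 [Ev Eu] N]]]]].
have [_ a0 Ea EQ] := pell_stepP rs.
case: rs => [_ lePr ltrPQ _ _].
move: (pell_step s) (pell_quotient s) a0 Ea EQ => [P' Q'] a a0 /= Ea EQ.
case: s lePr ltrPQ Ev Eu N Ea EQ => P Q /= lePr ltrPQ Ev Eu N Ea EQ.
have {}Ea : (P'%:Z = a%:Z * Q%:Z - P%:Z)%R by rewrite -PoszM -Ea PoszD addrK.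
have {}EQ : (Q%:Z * Q'%:Z = d%:Z - P'%:Z ^+ 2)%R.
  by move: EQ; rewrite -mulnn => <-; rewrite PoszD !PoszM expr2 addrK.
have Q0 : (Q%:Z != 0)%R by lia.
pose p' := (u + a%:Z * p)%R; pose q' := (v + a%:Z * q)%R.
have q'0 : (0 < q')%R.
  by apply: lt_le_trans qv0 _; rewrite addrC lerD2l ler_peMl // lez_nat.
have Ep' : (Q%:Z * p' = q * d%:Z + p * P'%:Z)%R by rewrite /p' mulrDr -Eu Ea; ring.
have Eq' : (Q%:Z * q' = p + q * P'%:Z)%R by rewrite /q' mulrDr -Ev Ea; ring.
have N' : (p' ^+ 2 - d%:Z * q' ^+ 2 = Q'%:Z \/ p' ^+ 2 - d%:Z * q' ^+ 2 = - Q'%:Z)%R.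
  have E : (Q%:Z ^+ 2 * (p' ^+ 2 - d%:Z * q' ^+ 2) = - (Q%:Z * Q'%:Z) * (p ^+ 2 - d%:Z * q ^+ 2))%R.
    transitivity ((Q%:Z * p') ^+ 2 - d%:Z * (Q%:Z * q') ^+ 2)%R; first by ring.
    by rewrite EQ Ep' Eq'; ring.
  have Q2 : (Q%:Z ^+ 2 != 0)%R by rewrite expf_neq0.
  by case: N => N; [right | left]; apply: (mulfI Q2); rewrite E N; ring.
exists p', q'; split=> //; exists p', q', p, q; split=> //.
- exact: ltW.
- by rewrite ltr_pwDl.
- split; apply: (mulfI Q0).
    have -> : (Q%:Z * (p' - q' * P'%:Z) = Q%:Z * p' - (Q%:Z * q') * P'%:Z)%R by ring.
    by rewrite Ep' Eq' mulrA EQ; ring.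
  have -> : (Q%:Z * (q' * d%:Z - p' * P'%:Z) = (Q%:Z * q') * d%:Z - (Q%:Z * p') * P'%:Z)%R by ring.
  by rewrite Ep' Eq' mulrA EQ; ring.
Qed.

(** Reduced pairs are finite in number and the step is injective on them, so the orbit of [(r, 1)],
    the pair of [r + sqrt d], returns to its start. *)
Lemma pell_cycle : exists2 k, 0 < k & iter k pell_step (r, 1) = (r, 1).
Proof.
have red k : pell_reduced (iter k pell_step (r, 1)).
  elim: k => [|k IHk]; last by case: (pell_stepP IHk).
  by split; rewrite /= ?dvd1n //; lia.
pose S := ('I_r.+1 * 'I_(r.*2).+1)%type.
have bnd k : (((iter k pell_step (r, 1)).1 < r.+1) * ((iter k pell_step (r, 1)).2 < (r.*2).+1))%type.
  by have [_ le1 _ le2 _] := red k; split; lia.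
pose F (k : 'I_(#|{: S}|.+1)) : S := (Ordinal (bnd k).1, Ordinal (bnd k).2).
have /injectivePn[i [j neqij Eij]] : ~~ injectiveb F.
  apply/negP => /injectiveP/leq_card; by rewrite card_ord ltnn.
have {}Eij : iter i pell_step (r, 1) = iter j pell_step (r, 1).
  by case: Eij; case: (iter i _ _) (iter j _ _) => ? ? [? ?] /= -> ->.
have back m n : iter (m + n) pell_step (r, 1) = iter m pell_step (r, 1) ->
    iter n pell_step (r, 1) = (r, 1).
  by elim: m => // m IHm; rewrite addSn !iterS => /pell_step_inj/IHm; apply.
wlog ltij : i j neqij Eij / i < j.
  move=> wl; have : i != j :> nat by [].
  by rewrite neq_ltn => /orP[/wl|/wl]; apply=> //; rewrite eq_sym.
exists (j - i); first by rewrite subn_gt0.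
by apply: (back i); rewrite subnKC // ltnW.
Qed.
End Pell.

Lemma pell_solution d : (0 < d)%N -> ~ nat_square d ->
  exists x y : nat, (0 < y /\ x ^ 2 = d * y ^ 2 + 1)%N.
Proof.
move=> d0 nsq.
have [r [r0 ltrd ltdr]] : exists r, [/\ 0 < r, r ^ 2 < d & d < r.+1 ^ 2]%N.
  have ex : exists r, (r ^ 2 <= d)%N by exists 0%N.
  have bnd r : (r ^ 2 <= d)%N -> (r <= d)%N.
    by move=> le; apply: leq_trans le; rewrite expnS expn1; case: r => // r; rewrite leq_pmulr.
  have [r le max] := ex_maxnP ex bnd; exists r.
  have lt : (r ^ 2 < d)%N.
    by rewrite ltn_neqAle le andbT; apply/eqP => E; apply: nsq; exists r.
  have ltd : (d < r.+1 ^ 2)%N by rewrite ltnNge; apply/negP => /max; rewrite ltnn.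
  by split=> //; case: (r) ltd => //; rewrite exp1n ltnS leqNgt d0.
have red k : pell_reduced d r (iter k (pell_step d r) (r, 1%N)).
  elim: k => [|k IHk]; last by case: (pell_stepP r0 ltrd ltdr IHk).
  by split; rewrite /= ?dvd1n //; lia.
have inv k : pell_invariant d (iter k (pell_step d r) (r, 1%N)).
  elim: k => [|k IHk]; last by have [p [q []]] := pell_invariant_step r0 ltrd ltdr (red k) IHk.
  (* The starting element is 1, of norm [Q = 1], with predecessor [sqrt d - r]. *)
  by exists 1, 0, (- r%:Z), 1; split=> //=; [split; ring | left; ring].
have [[|k] // _ Ek] := pell_cycle r0 ltrd ltdr.
have [p [q [q0 N _]]] := pell_invariant_step r0 ltrd ltdr (red k) (inv k).
rewrite -iterS Ek /= in N.
have absE (z : int) : z ^+ 2 = (`|z| ^ 2)%N%:Z by rewrite -abszX gez0_abs ?sqr_ge0.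
rewrite !absE in N; move: `|p|%N `|q|%N N (absz_gt0 q) => {p absE}m n N.
rewrite gt_eqF // => n0; case: N => N; first by exists m, n; split=> //; lia.
have m0 : (0 < m)%N.
  rewrite lt0n; apply/eqP => m0; apply: nsq; exists 1%N.
  have : (d * n ^ 2 == 1)%N by apply/eqP; lia.
  by rewrite muln_eq1 exp1n => /andP[/eqP].
(* Here [m + n sqrt d] has norm -1, and its square is the solution. *)
exists (m ^ 2 + d * n ^ 2)%N, (2 * m * n)%N; rewrite !muln_gt0 m0; split=> //.
have -> : (d * n ^ 2 = m ^ 2 + 1)%N by lia.
have -> : (d * (2 * m * n) ^ 2 = 4 * m ^ 2 * (d * n ^ 2))%N by ring.
have -> : (d * n ^ 2 = m ^ 2 + 1)%N by lia.
by ring.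
Qed.

(** * Minimal Pell solutions and their residue conditions *)

Section MinimalPell.
Local Open Scope nat_scope.

(** [f] is taken maximal with [f ^ 2] dividing [n]. Cancelling the gcd of [s] and [y] leaves a
    square dividing [d], which maximality forces to be 1. *)
Lemma squarefree_part n : 0 < n -> exists d f,
  [/\ n = d * f ^ 2, 0 < d, 0 < f & forall s y, s ^ 2 %| d * y ^ 2 -> s %| y].
Proof.
move=> n0.
have ex : exists f, f ^ 2 %| n by exists 1; rewrite exp1n dvd1n.
have bnd f : f ^ 2 %| n -> f <= n.
  by case: f => // f /(dvdn_leq n0); apply: leq_trans; rewrite expnS leq_pmulr.
have [f /dvdnP[d Dn] max] := ex_maxnP ex bnd.
have /andP[d0 f0] : (0 < d) && (0 < f) by move: n0; rewrite Dn muln_gt0 expn_gt0 orbF.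
exists d, f; split=> // s y dvd.
have [y0|y0] := posnP y; first by rewrite y0 dvdn0.
set g := gcdn s y; have g0 : 0 < g by rewrite gcdn_gt0 y0 orbT.
have /dvdnP[s' Ds] : g %| s by apply: dvdn_gcdl.
have /dvdnP[y' Dy] : g %| y by apply: dvdn_gcdr.
have co : coprime s' y'.
  rewrite /coprime -(eqn_pmul2r g0) mul1n; apply/eqP.
  by rewrite muln_gcdl -Ds -Dy.
have : s' ^ 2 %| d * y' ^ 2.
  by move: dvd; rewrite Ds Dy !expnMn mulnA dvdn_pmul2r ?expn_gt0 ?g0.
rewrite Gauss_dvdl ?coprime_pexpl ?coprime_pexpr // => /dvdnP[m Dm].
have : s' * f <= f by apply: max; rewrite Dn Dm expnMn -mulnA dvdn_mull.
rewrite -{2}[f]mul1n leq_pmul2r // => les'.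
have s'0 : 0 < s' by rewrite lt0n; apply: contraTneq d0 => s'0; rewrite Dm s'0 muln0.
have s'1 : s' = 1 by apply/eqP; rewrite eqn_leq les'.
rewrite Ds s'1 mul1n.
exact: dvdn_gcdr.
Qed.

(* Here [x = k.+1]. If [2 (x + 1)] were a square then [x + y sqrt d] would be the
   square of a smaller solution. *)
Lemma pell_minimal n : 0 < n -> ~ nat_square n -> exists d f k y,
  [/\ n = d * f ^ 2, 0 < f, 0 < y, k * k.+2 = d * y ^ 2 & ~ nat_square (2 * k.+2)].
Proof.
move=> n0 nsq; have [d [f [Dn d0 f0 sqf]]] := squarefree_part n0.
have nsqd : ~ nat_square d by case=> s Ds; apply: nsq; exists (s * f); rewrite Dn Ds expnMn.
pose sol y := (0 < y) && [exists x : 'I_(d * y ^ 2).+2, x ^ 2 == d * y ^ 2 + 1].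
have solP x y : 0 < y -> x ^ 2 = d * y ^ 2 + 1 -> sol y.
  move=> y0 E; rewrite /sol y0; apply/existsP.
  have ltx : x < (d * y ^ 2).+2.
    by rewrite ltnS -addn1 -E; case: (x) => // z; rewrite expnS leq_pmulr.
  by exists (Ordinal ltx); rewrite /= E.
have ex : exists y, sol y.
  by have [x [y [y0 E]]] := pell_solution d0 nsqd; exists y; apply: solP E.
have [y /andP[y0 /existsP[x /eqP Dx]] min] := ex_minnP ex.
have x0 : 0 < x by case: (nat_of_ord x) Dx => //; rewrite addn1.
exists d, f, x.-1, y; split=> //.
  by move: Dx; case: (nat_of_ord x) x0 => //= k _; rewrite -mulnn; lia.
rewrite prednK // => -[s Ds].
have /dvdnP[z Dz] : 2 %| s.
  have : 2 %| s ^ 2 by rewrite -Ds dvdn_mulr.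
  by rewrite Euclid_dvdX // => /andP[].
have Dx1 : x.+1 = 2 * z ^ 2.
  by apply/eqP; rewrite -(eqn_pmul2l (isT : 0 < 2)) Ds Dz; apply/eqP; ring.
have z0 : 0 < z by case: (z) Dx1 => //; rewrite muln0.
(* From [x = 2 z^2 - 1]. As [d] is squarefree, [2 z] divides [y], and the quotient [w] is a smaller
   solution: [z^2 = d w^2 + 1]. *)
have E : d * y ^ 2 = (z * 2) ^ 2 * (z ^ 2 - 1).
  have : d * y ^ 2 + 1 = x ^ 2 by rewrite Dx.
  have -> : nat_of_ord x = 2 * z ^ 2 - 1 by rewrite -Dx1 subn1.
  have : 0 < z ^ 2 by rewrite expn_gt0 z0.
  case: (z ^ 2) (expnMn z 2 2) => // w -> _; rewrite subn1 /= mulnS; nia.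
have /sqf/dvdnP[w Dy] : (z * 2) ^ 2 %| d * y ^ 2 by rewrite E dvdn_mulr.
have w0 : 0 < w by case: (w) Dy y0 => // ->.
have Ew : z ^ 2 = d * w ^ 2 + 1.
  rewrite -(subnK (_ : 0 < z ^ 2)) ?expn_gt0 ?z0 //; congr (_ + _); apply/eqP.
  have z20 : 0 < (z * 2) ^ 2 by rewrite expn_gt0 muln_gt0 z0.
  by rewrite -(eqn_pmul2l z20) -E Dy; apply/eqP; ring.
have := min w (solP _ _ w0 Ew); rewrite Dy leqNgt ltn_Pmulr //.
by clear -z0; lia.
Qed.
End MinimalPell.

Section PellResidues.
Local Open Scope nat_scope.
Variables d f k y q : nat.
Hypotheses (f0 : 0 < f) (y0 : 0 < y) (d0 : 0 < d) (Ek : k * k.+2 = d * y ^ 2).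
Hypotheses (pr_q : prime q) (q2 : 2 < q) (odd_q : odd (logn q (d * f ^ 2))).

Let k0 : 0 < k.
Proof.
have : 0 < k * k.+2 by rewrite Ek muln_gt0 d0 expn_gt0 y0.
by rewrite muln_gt0 => /andP[].
Qed.

Let odd_k : odd (logn q k) (+) odd (logn q k.+2).
Proof.
rewrite -oddD -lognM // Ek; move: odd_q; rewrite !lognM ?expn_gt0 ?f0 ?y0 //.
by rewrite !oddD !addbb !addbF.
Qed.

Let dvdq m : odd (logn q m) -> q %| m.
Proof. by rewrite lognE; case: and3P => // -[]. Qed.

Let logn_q m v : 0 < m -> 0 < v -> ~~ (q %| v) -> logn q (2 * m * v) = logn q m.
Proof.
move=> m0 v0 qv; rewrite -mulnA mulnCA lognM ?muln_gt0 //.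
rewrite (@logn_coprime q (2 * v)) ?addn0 // coprimeMr !prime_coprime // qv.
by rewrite gtnNdvd.
Qed.

(** Exactly one of [k] and [k.+2] has odd valuation at [q]. The square rules out [k.+2], so [q]
    divides [k] and [2 * k.+2 * v] is [4 * v] modulo [q]. *)
Lemma pell_residue v : 0 < v -> ~~ (q %| v) -> nat_square (2 * k.+2 * v) ->
  exists s, s ^ 2 = 4 * v %[mod q].
Proof.
move=> v0 qv sq; have := odd_logn_nat_square q _ sq.
rewrite logn_q // !muln_gt0 v0 => /(_ isT) /negPf E.
move: odd_k; rewrite E addbF => /dvdq /dvdnP[m Dk].
have [s Ds] := sq; exists s; rewrite -Ds Dk.
have -> : 2 * (m * q).+2 * v = 2 * m * v * q + 4 * v by ring.
by rewrite modnMDl.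
Qed.

(** Since [k * k.+2] has the class of [d], also [2 * k * w] is a square. Now [q] must divide [k.+2],
    which makes this square [- 4 w] modulo [q]. *)
Lemma pell_residueN v w : 0 < v -> 0 < w -> ~~ (q %| w) ->
    nat_square (v * w * (d * f ^ 2)) -> nat_square (2 * k.+2 * v) ->
  exists s, q %| s ^ 2 + 4 * w.
Proof.
move=> v0 w0 qw sqvw sqv.
have sq : nat_square (2 * k * w).
  apply: (@nat_square_div (2 * k.+2 * v)) => //; first by rewrite !muln_gt0.
  apply: (@nat_square_div (f ^ 2)); [by rewrite expn_gt0 f0 | by exists f |].
  have -> : f ^ 2 * (2 * k.+2 * v * (2 * k * w)) = (2 * y) ^ 2 * (v * w * (d * f ^ 2)).
    have -> : f ^ 2 * (2 * k.+2 * v * (2 * k * w)) = f ^ 2 * (4 * v * w) * (k * k.+2) by ring.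
    by rewrite Ek; ring.
  by apply: nat_squareM => //; exists (2 * y).
have := odd_logn_nat_square q _ sq.
rewrite logn_q // !muln_gt0 w0 k0 => /(_ isT) /negPf E.
move: odd_k; rewrite E /= => /dvdq /dvdnP[m Dk].
have [s Ds] := sq; exists s; rewrite -Ds.
have -> : 2 * k * w + 4 * w = 2 * k.+2 * w by ring.
by rewrite Dk mulnA mulnAC dvdn_mull.
Qed.
End PellResidues.

(** * Rank three *)

Section ResidueTable.
Local Open Scope nat_scope.

(* An entry (q, i, sq) stands for a prime q that will divide exactly the i-th
   number of the family; sq lists the squares modulo q. *)
Definition residue_table : seq (nat * nat * seq nat) :=
  [:: (13, 1, [:: 0; 1; 3; 4; 9; 10; 12]);
   (17, 0, [:: 0; 1; 2; 4; 8; 9; 13; 15; 16]);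
   (19, 2, [:: 0; 1; 4; 5; 6; 7; 9; 11; 16; 17]);
   (23, 0, [:: 0; 1; 2; 3; 4; 6; 8; 9; 12; 13; 16; 18]);
   (29, 3, [:: 0; 1; 4; 5; 6; 7; 9; 13; 16; 20; 22; 23; 24; 25; 28]);
   (31, 3, [:: 0; 1; 2; 4; 5; 7; 8; 9; 10; 14; 16; 18; 19; 20; 25; 28]);
   (37, 3, [:: 0; 1; 3; 4; 7; 9; 10; 11; 12; 16; 21; 25; 26; 27; 28; 30; 33; 34; 36]);
   (41, 3, [:: 0; 1; 2; 4; 5; 8; 9; 10; 16; 18; 20; 21; 23; 25; 31; 32; 33; 36; 37; 39; 40]);
   (43, 1, [:: 0; 1; 4; 6; 9; 10; 11; 13; 14; 15; 16; 17; 21; 23; 24; 25; 31; 35; 36; 38; 40; 41])].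

Definition small_prime k := nth 1 [:: 2; 3; 5; 7; 11] k.
(** The differences 42, 44, 45, 2, 3, 1 involve only the primes 2, 3, 5, 7, 11. *)
Definition offset i := nth 0 [:: 0; 42; 44; 45] i.

Definition generator (l : nat -> nat) k := if k < 5 then small_prime k else l (k - 5).

(** If [q] divides [M + offset i], then [M] is [- offset i] modulo [q]; the summand [4 * q] keeps
    the subtraction from truncating. *)
Definition residue q i k :=
  (if k < 5 then small_prime k else offset (k - 5) + 4 * q - offset i) %% q.

Definition residue_prod q i (b : nat -> bool) :=
  foldr (fun k m => if b k then residue q i k * m %% q else m) 1 (iota 0 9).

(** Flipping only the bits of the [l i] makes the product of both selections contain each [l i] once
    and the small primes to even powers. *)
Definition complement_bits (b : nat -> bool) k := if k < 5 then b k else ~~ b k.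

(* If [v] is the product of the generators selected by [b] and [2 (x + 1) v] is a
   square, then [4 v] is a square modulo [q] when [q] does not divide [v]; otherwise
   the same holds for [- 4 w], where [w] is prime to [q] and [v w] is
   [l_0 l_1 l_2 l_3] up to squares. *)
Definition excluded (b : nat -> bool) :=
  has (fun e : nat * nat * seq nat => let: (q, i, sq) := e in
    if b (5 + i) then
      let m := 4 * residue_prod q i (complement_bits b) in
      all (fun z => (z + m) %% q != 0) sq
    else let m := 4 * residue_prod q i b %% q in all (fun z => z != m) sq)
  residue_table.

Fixpoint all_bits n (P : seq bool -> bool) :=
  if n is n'.+1 then
    all_bits n' (fun s => P (true :: s)) && all_bits n' (fun s => P (false :: s))
  else P [::].

Lemma all_bitsP n P s : all_bits n P -> size s = n -> P s.
Proof.
elim: n P s => [|n IHn] P [|b s] //= /andP[Pt Pf] [szs].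
by case: b; [exact: (IHn _ _ Pt szs) | exact: (IHn _ _ Pf szs)].
Qed.

(** The finite computation that disposes of all 511 nontrivial selections of the nine generators. *)
Lemma excluded_bits :
  all_bits 9 (fun s => has id s ==> excluded (nth false s)).
Proof. by vm_compute. Qed.

Lemma residue_tableP :
  all (fun e : nat * nat * seq nat => let: (q, i, sq) := e in
    [&& prime q, 2 < q, i < 4, all (fun k => (residue q i k == 0) == (k == 5 + i)) (iota 0 9)
      & all (fun s => s ^ 2 %% q \in sq) (iota 0 q)]) residue_table.
Proof. by vm_compute. Qed.

Lemma residue_table_uniq : uniq [seq e.1.1 | e <- residue_table].
Proof. by []. Qed.

Lemma residue_prodE q i b :
  residue_prod q i b = \prod_(k < 9) residue q i k ^ b k %[mod q].
Proof.
rewrite -(big_mkord xpredT (fun k => residue q i k ^ b k)) /residue_prod /index_iota subn0.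
elim: (iota 0 9) => [|k s IHs]; first by rewrite big_nil.
rewrite big_cons /=; case: (b k); last by rewrite expn0 mul1n.
by rewrite expn1 modn_mod -modnMmr IHs modnMmr.
Qed.
End ResidueTable.

(** * The family with offsets 0, 42, 44, 45 *)

Section SpecialFamily.
Local Open Scope nat_scope.
Variable M : nat.
Hypothesis M_small : {in [:: 42; 44; 45], forall c, c %| M}.
Hypothesis M_table : {in residue_table, forall e, M + offset e.1.2 = e.1.1 %[mod e.1.1 ^ 2]}.

Let l i := M + offset i.

Let tableP q i sq : (q, i, sq) \in residue_table ->
  [/\ prime q, 2 < q, i < 4, forall k, k < 9 -> (residue q i k == 0) = (k == 5 + i)
    & forall s, s ^ 2 %% q \in sq].
Proof.
move=> etab; have /allP/(_ _ etab) := residue_tableP.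
case/and5P=> pr_q q2 i4 /allP res /allP sqs; split=> // [k ltk|s].
  by have := res k; rewrite mem_iota add0n => /(_ ltk)/eqP.
rewrite -modnXm; apply: sqs; rewrite mem_iota add0n ltn_mod /=.
exact: prime_gt0.
Qed.

Let M0 : 0 < M.
Proof.
(* The entry for 17 has index 0, so [M] is 17 modulo [17 ^ 2], hence nonzero. *)
have etab : (17, 0, nth [::] [seq e.2 | e <- residue_table] 1) \in residue_table by [].
by case: M (M_table etab).
Qed.

Let l0 i : 0 < l i. Proof. by rewrite addn_gt0 M0. Qed.

Let gen0 k : k < 9 -> 0 < generator l k.
Proof.
rewrite /generator; case: (ltnP k 5) => [ltk5|_] _; last exact: l0.
by case: k ltk5 => [|[|[|[|[|]]]]].
Qed.

Let gen_residue q i sq k : (q, i, sq) \in residue_table -> k < 9 ->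
  generator l k = residue q i k %[mod q].
Proof.
move=> etab ltk; have [pr_q q2 i4 _ _] := tableP etab.
rewrite /generator /residue modn_mod; case: (ltnP k 5) => // le5k.
have q13 : 13 <= q.
  by have /allP/(_ _ etab) : all (fun e => 13 <= e.1.1) residue_table by [].
have li0 : l i = 0 %[mod q].
  have := M_table etab; rewrite /= => E.
  by rewrite mod0n -(modn_dvdm (l i) (dvdn_exp (isT : 0 < 2) (dvdnn q))) E modn_dvdm ?dvdn_exp // modnn.
have off_q : offset i <= 4 * q.
  have le45 : offset i <= 45 by case: i i4 {etab li0} => [|[|[|[|]]]].
  by clear -le45 q13; lia.
apply/eqP; rewrite -(eqn_modDr (offset i)); apply/eqP.
rewrite subnK ?(leq_trans off_q) ?leq_addl //.
have -> : l (k - 5) + offset i = l i + offset (k - 5) by rewrite /l addnAC.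
by rewrite -modnDml li0 mod0n add0n addnC modnMDl.
Qed.

Let logn_gen q i sq k : (q, i, sq) \in residue_table -> k < 9 ->
  logn q (generator l k) = (k == 5 + i).
Proof.
move=> etab ltk; have [pr_q q2 i4 res _] := tableP etab.
have [->|neq] := eqVneq k (5 + i).
  by rewrite /generator /= addKn; apply: logn_prime_mod => //; apply: M_table etab.
apply: logn_coprime; rewrite prime_coprime // /dvdn (gen_residue etab) //.
by rewrite /residue modn_mod -/(residue q i k) res // (negPf neq).
Qed.

Let gen_prod (e : nat -> nat) := \prod_(k < 9) generator l k ^ e k.

Let gen_prod0 e : 0 < gen_prod e.
Proof. by rewrite prodn_gt0 // => k; rewrite expn_gt0 gen0. Qed.

Let gen_prodE e : gen_prod e =
  (\prod_(i < 4) l i ^ e (5 + i)) * \prod_(k < 5) small_prime k ^ e k.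
Proof.
rewrite /gen_prod (@big_split_ord _ _ _ 5 4) mulnC /=; congr (_ * _).
  by apply: eq_bigr => i _; rewrite /generator /= ltn_ord.
by apply: eq_bigr => i _; rewrite /generator /= addKn.
Qed.

(** The table primes 17, 13, 19, 29 detect [l 0], ..., [l 3]; once these are removed, the small
    primes detect themselves. *)
Let gen_prod_square e : nat_square (gen_prod e) -> forall k, k < 9 -> ~~ odd (e k).
Proof.
rewrite gen_prodE; set c := \prod_(k < 5) _ => sq.
pose qs i := nth 0 [:: 17; 13; 19; 29] i.
have qsP i : i < 4 -> exists sq, (qs i, i, sq) \in residue_table.
  move=> i4; exists (nth [::] [seq e.2 | e <- residue_table] (nth 0 [:: 1; 0; 2; 4] i)).
  by case: i i4 => [|[|[|[|]]]].
have sp0 (k : 'I_5) : 0 < small_prime k ^ e k.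
  by rewrite expn_gt0 (_ : 0 < small_prime k) //; case: k => -[|[|[|[|[|]]]]].
have c0 : 0 < c by rewrite prodn_gt0.
have pl i k : i < 4 -> k < 4 -> logn (qs k) (l i) = (i == k).
  move=> i4 /qsP[sqs etab]; have := logn_gen etab (_ : 5 + i < 9).
  by rewrite /generator /= addKn eqn_add2l; apply.
have pc k : k < 4 -> logn (qs k) c = 0.
  case/qsP=> sqs etab; rewrite /c logn_prod // big1 // => j _.
  have := logn_gen etab (ltn_trans (ltn_ord j) (isT : 5 < 9)).
  rewrite /generator ltn_ord lognX => ->.
  by rewrite ltn_eqF ?muln0 // ltn_addr.
have [ev sqc] := nat_square_detect (e := fun i => e (5 + i)) c0 (fun i _ => l0 i) pl pc sq.
have sp0' k : k < 5 -> 0 < small_prime k by case: k => [|[|[|[|[|]]]]].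
have spl i k : i < 5 -> k < 5 -> logn (small_prime k) (small_prime i) = (i == k).
  by case: i => [|[|[|[|[|]]]]] //; case: k => [|[|[|[|[|]]]]].
rewrite -[c]muln1 in sqc.
have [ev' _] := nat_square_detect (isT : 0 < 1) sp0' spl (fun k _ => logn1 _) sqc.
move=> k ltk; have [k5|le5k] := ltnP k 5; first exact: ev'.
by have := ev (k - 5); rewrite subnKC //; apply; rewrite ltn_subLR.
Qed.

(** Only the parities of [e] matter. If all are even, [nsq] is contradicted; otherwise some table
    prime contradicts [pell_residue] or [pell_residueN]. *)
Lemma pell_class_excluded d f k y e :
    l 0 * l 1 * l 2 * l 3 = d * f ^ 2 -> 0 < f -> 0 < y ->
    k * k.+2 = d * y ^ 2 -> ~ nat_square (2 * k.+2) ->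
  ~ nat_square (2 * k.+2 * gen_prod e).
Proof.
move=> Dd f0 y0 Ek nsq sqe.
have D0 : 0 < d * f ^ 2 by rewrite -Dd !muln_gt0 !l0.
have d0 : 0 < d by move: D0; rewrite muln_gt0 => /andP[].
pose s := mkseq (odd \o e) 9; pose b := nth false s.
have Db j : j < 9 -> b j = odd (e j) by move=> ltj; rewrite /b nth_mkseq.
have sq : nat_square (2 * k.+2 * gen_prod b).
  apply: (@nat_square_div (gen_prod (fun j => (e j)./2) ^ 2)).
  - by rewrite expn_gt0 gen_prod0.
  - by exists (gen_prod (fun j => (e j)./2)).
  rewrite mulnCA; suff -> : gen_prod (fun j => (e j)./2) ^ 2 * gen_prod b = gen_prod e by [].
  rewrite /gen_prod (big_morph (expn^~ 2) (fun x y => expnMn x y 2) (exp1n 2)).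
  rewrite -big_split; apply: eq_bigr => j _ /=.
  by rewrite -expnM -expnD Db // addnC muln2 odd_double_half.
have gp_neq0 (b' : nat -> bool) q i sqs : (q, i, sqs) \in residue_table ->
    b' (5 + i) = false -> ~~ (q %| gen_prod b').
  move=> etab b'i; have [pr_q _ _ _ _] := tableP etab.
  rewrite -prime_coprime // coprime_sym; apply/(big_ind (coprime^~ q)) => [|u v|j _].
  - by rewrite coprime1n.
  - by rewrite coprimeMl => -> ->.
  case bj : (b' j); last by rewrite coprime1n.
  rewrite expn1 coprime_sym prime_coprime //; apply/negP => dvd.
  have := logn_gen etab (ltn_ord j); case: eqP => [ej|_]; first by rewrite ej b'i in bj.
  by move/eqP; rewrite -leqn0 leqNgt logn_gt0 mem_primes pr_q gen0 // dvd.
have gp_res (b' : nat -> bool) q i sqs : (q, i, sqs) \in residue_table ->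
    residue_prod q i b' = gen_prod b' %[mod q].
  move=> etab; rewrite residue_prodE /gen_prod.
  apply: (big_ind2 (fun u v => u = v %[mod q])) => // [u v u' v' E E'|j _].
    by rewrite -modnMm E E' modnMm.
  by rewrite -modnXm -(gen_residue etab) // modnXm.
have [b0|] := boolP (has id s); last first.
  move/hasPn => b0; apply: nsq; move: sq; rewrite /gen_prod big1 ?muln1 // => j _.
  by rewrite (negPf (b0 (b j) _)) // mem_nth ?size_mkseq.
have /implyP/(_ b0)/hasP[[[q i] sqs] etab] := all_bitsP excluded_bits (size_mkseq _ _ : size s = 9).
have [pr_q q2 i4 _ sqsP] := tableP etab.
have odd_q : odd (logn q (d * f ^ 2)).
  have lq j : j < 4 -> logn q (l j) = (j == i).
    by move=> j4; have := logn_gen etab (_ : 5 + j < 9); rewrite /generator /= addKn eqn_add2l; apply.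
  rewrite -Dd !lognM ?muln_gt0 ?l0 // !lq //.
  by case: i i4 {etab lq} => [|[|[|[|]]]].
rewrite -/b; case bi : (b (5 + i)) => /allP excl.
  set c := complement_bits b in excl; have ci : c (5 + i) = false by rewrite /c /complement_bits /= bi.
  have sqc : nat_square (gen_prod b * gen_prod c * (d * f ^ 2)).
    exists ((\prod_(k < 5) small_prime k ^ b k) * (l 0 * l 1 * l 2 * l 3)).
    rewrite -Dd !gen_prodE !big_ord_recl !big_ord0 /= /bump /= /c /complement_bits /=.
    by move: (b 5) (b 6) (b 7) (b 8) => [] [] [] [] /=; ring.
  have [z dvd] := pell_residueN f0 y0 d0 Ek pr_q q2 odd_q (gen_prod0 _) (gen_prod0 _)
    (gp_neq0 _ _ _ _ etab ci) sqc sq.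
  have /negP[] := excl _ (sqsP z).
  by rewrite modnDml -modnDmr -modnMmr (gp_res _ _ _ _ etab) modnMmr modnDmr.
have [z Ez] := pell_residue f0 y0 d0 Ek pr_q q2 odd_q (gen_prod0 _) (gp_neq0 _ _ _ _ etab bi) sq.
have /negP[] := excl _ (sqsP z).
by rewrite Ez -modnMmr -(gp_res _ _ _ _ etab) modnMmr.
Qed.
Let dvd_l i j : i < j -> j < 4 -> l i < l j /\ (l j - l i) %| l i.
Proof.
move=> ltij ltj; rewrite /l subnDl ltn_add2l.
have M_dvd c : has (dvdn c) [:: 42; 44; 45] -> c %| M.
  by case/hasP=> m /M_small mM cm; apply: dvdn_trans cm mM.
by case: j ltj ltij => [|[|[|[|]]]] // _; case: i => [|[|[|]]] // _; rewrite dvdn_addr ?M_dvd.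
Qed.

Let pairs h := nth (0, 0) [:: (0, 1); (0, 2); (0, 3); (1, 2); (1, 3); (2, 3)] h.

Lemma special_unit_numbers : exists x, @unit_numbers 3 7 (family_gen l) x.
Proof.
pose D := l 0 * l 1 * l 2 * l 3.
have D0 : 0 < D by rewrite !muln_gt0 !l0.
have nsqD : ~ nat_square D.
  move=> sqD; have := @gen_prod_square (fun k => 4 < k : nat) _ 5 isT => /(_ _)/negP[] //.
  by rewrite gen_prodE !big_ord_recl !big_ord0 /= !muln1 !expn1 !mulnA.
have [d [f [k [y [Dd f0 y0 Ek nsq]]]]] := pell_minimal D0 nsqD.
have excl e := pell_class_excluded (e := e) Dd f0 y0 Ek nsq.
have pr_lt (h : 'I_6) : (pairs h).1 < (pairs h).2 by case: h => -[|[|[|[|[|[|]]]]]].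
have pr_ltn (h : 'I_6) : (pairs h).2 < 4 by case: h => -[|[|[|[|[|[|]]]]]].
exists (fun h => if h < 6 then pair_unit l (pairs h).1 (pairs h).2 else k.+1).
split=> [i lti|h|h|s t].
- by rewrite muln_gt0 !l0.
- case: (ltnP h 6) => // h6.
  by have [m [n [_ _ _ _ ->]]] := pair_unit_spec dvd_l (pr_lt (Ordinal h6)) (pr_ltn (Ordinal h6)).
- case: (ltnP h 6) => [h6|_].
    exact: (pair_unit_sqrt dvd_l (pr_lt (Ordinal h6)) (pr_ltn (Ordinal h6))).
  (* The product of the three generators is [l 0 ^ 2 * D], of the same class as [d]. *)
  exists xpredT; rewrite Ek !big_ord_recl big_ord0 /= /family_gen !expn1 /bump /= muln1.
  exists (d * y * f * l 0).
  have -> : l 0 * l 1 * (l 0 * l 2 * (l 0 * l 3)) = l 0 ^ 2 * D by rewrite /D; ring.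
  by rewrite Dd; ring.
pose t' n := t (inord n); have Et h : t h = t' h by rewrite /t' inord_val.
rewrite big_ord_recr /= -mulnA.
have -> : t ord_max = t' 6 by rewrite Et.
rewrite (eq_bigr (fun h : 'I_6 =>
    (2 * (pair_unit l (pairs h).1 (pairs h).2).+1) ^ t' h)) => [|h _]; last first.
  by rewrite ltn_ord Et.
move/(pair_units_class dvd_l pr_lt pr_ltn) => sq.
pose T n := t' n : nat; pose S n := s n : nat.
(* Exponents of 2, 3, 5, 7, 11, [l 0], ..., [l 3] after replacing the unit of a pair [(i, j)] by
   [l j * (l j - l i)] and dropping squares. *)
pose E n := nth 0 [:: T 0 + T 3; T 0 + T 4; T 2; T 0; T 1;
  S 0 + S 1 + S 2; S 0 + T 0; S 1 + T 1 + T 3; S 2 + T 2 + T 4 + T 5] n.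
have {}sq : nat_square ((2 * k.+2) ^ T 6 * gen_prod E).
  (* The dropped squares come from [44 = 2 ^ 2 * 11] and [45 = 3 ^ 2 * 5]. *)
  apply: (@nat_square_div ((2 ^ T 1 * 3 ^ T 2) ^ 2)); first by rewrite expn_gt0 muln_gt0 !expn_gt0.
    by exists (2 ^ T 1 * 3 ^ T 2).
  move: sq; rewrite /gen_prod !big_ord_recl !big_ord0 /= /bump /= !add1n.
  have [-> -> ->] : [/\ l 1 - l 0 = 2 * 3 * 7, l 2 - l 0 = 2 ^ 2 * 11 & l 3 - l 0 = 3 ^ 2 * 5].
    by rewrite /l !subnDl.
  have [-> -> ->] : [/\ l 2 - l 1 = 2, l 3 - l 1 = 3 & l 3 - l 2 = 1] by rewrite /l !subnDl.
  rewrite /generator /family_gen /E /= /small_prime /= -/(T _) -!/(T _) -!/(S _).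
  move: (T 0) (T 1) (T 2) (T 3) (T 4) (T 5) (T 6) (S 0) (S 1) (S 2) => a0 a1 a2 a3 a4 a5 a6 s0 s1 s2.
  case=> z Dz; exists z; rewrite -{z}Dz.
  rewrite !(expnMn, expnD) exp1n -[5 - 5]/0 -[6 - 5]/1 -[7 - 5]/2 -[8 - 5]/3.
  by ring.
have t6 : t' 6 = false.
  by apply/negP => t6; apply: (excl E); move: sq; rewrite /T t6 expn1.
rewrite /T t6 expn0 mul1n in sq; have ev := gen_prod_square sq.
(* The exponents of 7, 11 and 5 isolate [t' 0], [t' 1] and [t' 2]; those of 2 and 3 then give [t' 3]
   and [t' 4]. *)
have /and5P[/negPf t0 /negPf t1 /negPf t2 /negPf t3 /negPf t4] :
    [&& ~~ t' 0, ~~ t' 1, ~~ t' 2, ~~ t' 3 & ~~ t' 4].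
  move: (ev 3 isT) (ev 4 isT) (ev 2 isT) (ev 0 isT) (ev 1 isT); rewrite /E /T /= !oddD !oddb.
  by move=> /negPf-> /negPf-> /negPf->; rewrite !addFb => -> ->.
(* Now [l 1] and [l 2] isolate [s 0] and [s 1], then [l 0] gives [s 2] and [l 3] gives [t' 5]. *)
have /and4P[/negPf s0 /negPf s1 /negPf s2 /negPf t5] : [&& ~~ s 0, ~~ s 1, ~~ s 2 & ~~ t' 5].
  move: (ev 5 isT) (ev 6 isT) (ev 7 isT) (ev 8 isT).
  rewrite /E /T /S /= t0 t1 t2 t3 t4 !oddD !oddb !addbF.
  move=> s012 /negPf s0 /negPf s1; move: s012; rewrite s0 s1 !addFb => /negPf->.
  by rewrite addFb => ->.
split=> [[|[|[|]]] //|h]; rewrite Et.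
by case: h => -[|[|[|[|[|[|[|]]]]]]].
Qed.

Lemma logn_first_gen q : prime q -> 45 < q -> M = q %[mod q ^ 2] -> logn q (l 0 * l 1) = 1.
Proof.
move=> pr_q q45 Mq; rewrite lognM //.
have q2q : q %| q ^ 2 by apply: dvdn_exp.
have qM : q %| M by rewrite /dvdn -(modn_dvdm M q2q) Mq modn_dvdm // modnn.
rewrite (logn_prime_mod pr_q) ?[l 0]addn0 // logn_coprime //.
by rewrite prime_coprime // dvdn_addr // gtnNdvd // (leq_trans _ q45).
Qed.
End SpecialFamily.

Lemma special_modulus : exists2 N, {in [:: 42; 44; 45]%N, forall c, c %| N}%N
  & forall p, prime p -> (11 < p)%N -> coprime p N.
Proof.
exists (42 * (44 * 45))%N => [c|p pr_p p11].
  rewrite !inE => /or3P[]/eqP->; first exact: dvdn_mulr.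
    by rewrite dvdn_mull // dvdn_mulr.
  by rewrite dvdn_mull // dvdn_mull.
have co m : (0 < m)%N && all (leq^~ 11) (primes m) -> coprime p m.
  case/andP=> m0 /allP small; rewrite prime_coprime //; apply/negP => pm.
  by have := small p; rewrite mem_primes pr_p m0 pm leqNgt p11 => /(_ isT).
by rewrite !coprimeMr !co.
Qed.

Lemma infinitely_many_special : infinitely_many_good 3 7.
Proof.
apply: infinitely_many_of_numbers => // B.
have [q Bq pr_q] := prime_above (maxn B 45).
have q45 : (45 < q)%N by apply: leq_ltn_trans Bq; apply: leq_maxr.
have [N dvdN coN] := special_modulus.
pose tab_mods := [seq (e.1.1 ^ 2, e.1.1 ^ 2 + e.1.1 - offset e.1.2)%N | e <- residue_table].
have tab e : e \in residue_table -> prime e.1.1 /\ (11 < e.1.1 <= 45)%N.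
  have /allP/(_ e) tabP : all (fun e : nat * nat * seq nat =>
    prime e.1.1 && (11 < e.1.1 <= 45)%N) residue_table by [].
  by case/tabP/andP.
have tab_modsP u : u \in tab_mods ->
    exists p, [/\ u.1 = (p ^ 2)%N, prime p & (11 < p <= 45)%N].
  by case/mapP=> e /tab[pr_e le_e] ->; exists e.1.1.
(* The first congruence supplies the new prime [q], chosen above 45 to differ from the table primes;
   the second gives divisibility by 42, 44, 45; the others realize the table. *)
have [|M DM] := @crt ((q ^ 2, q) :: (N, 0) :: tab_mods)%N.
  rewrite 2!pairwise_cons; apply/and3P; split.
  - apply/allP => u; rewrite inE => /orP[/eqP-> | /tab_modsP[p [-> pr_p /andP[_ p45]]]].
      by rewrite coprimeXl // coN // (leq_trans _ q45).
    rewrite coprimeXl // coprimeXr // prime_coprime // gtnNdvd ?prime_gt0 //.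
    exact: leq_ltn_trans q45.
  - apply/allP => u /tab_modsP[p [-> pr_p /andP[p11 _]]].
    by rewrite coprimeXr // coprime_sym coN.
  rewrite /tab_mods pairwise_map; apply/(pairwiseP (0, 0, [::])%N) => i j; rewrite !inE => lti ltj ltij.
  have [pr_i _] := tab _ (mem_nth (0, 0, [::])%N lti).
  have [pr_j _] := tab _ (mem_nth (0, 0, [::])%N ltj).
  set u := nth _ _ i in pr_i *; set v := nth _ _ j in pr_j *.
  rewrite /= coprimeXl // coprimeXr // prime_coprime // dvdn_prime2 // /u /v.
  have := nth_uniq 0%N _ _ residue_table_uniq; rewrite size_map => /(_ i j lti ltj).
  by rewrite !(nth_map (0, 0, [::])%N) // => ->; rewrite ltn_eqF.
have DMe : {in residue_table, forall e, M = e.1.1 ^ 2 + e.1.1 - offset e.1.2 %[mod e.1.1 ^ 2]}%N.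
  move=> e etab; have := map_f (fun e => (e.1.1 ^ 2, e.1.1 ^ 2 + e.1.1 - offset e.1.2)%N) etab.
  by rewrite -/tab_mods => mods_e; apply: (DM (_, _)); rewrite 2!in_cons mods_e !orbT.
have M_small : {in [:: 42; 44; 45]%N, forall c, c %| M}%N.
  move=> c /dvdN cN; apply: dvdn_trans cN _.
  by rewrite /dvdn (DM (N, 0%N)) ?mod0n // 2!in_cons eqxx orbT.
have M_table : {in residue_table, forall e, M + offset e.1.2 = e.1.1 %[mod e.1.1 ^ 2]}%N.
  move=> e etab; rewrite -modnDml DMe // modnDml subnK ?modnDl //.
  by have /allP/(_ e etab) : all (fun e => offset e.1.2 <= e.1.1 ^ 2 + e.1.1)%N residue_table by [].
have [x xP] := special_unit_numbers M_small M_table.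
exists (family_gen (fun i => M + offset i)%N), x; split=> //.
exists q; split=> //; first by apply: leq_ltn_trans Bq; apply: leq_maxl.
rewrite /family_gen (logn_first_gen M_table) //.
by apply: (DM (_, _)); rewrite mem_head.
Qed.

Theorem theorem6p14 (t : nat) (ht : (1 <= t)%N) :
  infinitely_many_good (2 * t) (3 * t) /\ infinitely_many_good (3 * t) (7 * t).
Proof.
(* From [2 t + 1] numbers one gets [t (2 t + 1)] pairs, at least [3 t]. *)
split; first by apply: infinitely_many_of_pairs; rewrite ?bin2 /=; nia.
(* From [3 t + 1] numbers one gets [3 t (3 t + 1) / 2] pairs, at least [7 t] except for [t = 1],
   where there are only 6. *)
have [->|t1] := eqVneq t 1%N; first exact: infinitely_many_special.
by apply: infinitely_many_of_pairs; rewrite ?bin2 /=; nia.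
Qed.
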